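(* Let $q=16$, let $c_0\in(1,q)$ be a zero of $H_q(c)=\sum_{n\in\mathbb Z}(-1)^nq^{n/2}e^{-cq^n}$ ($c>0$), and let $$T=\{0\}\cup\bigcup_{m\ge0}B_m,\qquad B_m=\{c_0q^m+\ell q^{-2m}:1\le\ell\le q^m,\ \ell\in\mathbb N\}.$$ For every $m\in\mathbb N^+$ there exist a separable Hilbert space $H^{(m)}$, a positive diagonal contraction $A^{(m)}\in\mathcal B(H^{(m)})$, and an $m$-element family $\mathcal F^{(m)}=(f_1^{(m)},\dots,f_m^{(m)})\subset H^{(m)}$ such that $\mathcal O_{\mathbb N}(A^{(m)},\mathcal F^{(m)})$ is a frame for $H^{(m)}$, whereas $\mathcal O_T(A^{(m)},\mathcal F^{(m)})$ is Bessel but not a frame. Moreover, these can be chosen so that every eigenvalue of $A^{(m)}$ has multiplicity $m$, and $m$ is the minimal number of generating orbits for an integer time orbit frame generated by $A^{(m)}$ (i.e. the minimal number of vectors $g_1,\dots,g_r\in H^{(m)}$ for which $\{(A^{(m)})^ng_j:n\in\mathbb N,\,1\le j\le r\}$ is a frame for $H^{(m)}$). In particular, $m=1$ gives a singly generated positive diagonal Carleson frame whose $T$-sampled orbit is Bessel but not a frame.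
   Context: $\mathbb N=\{0,1,2,\dots\}$, $\mathbb N^+=\{1,2,\dots\}$. The series defining $H_q$ converges absolutely on $(0,\infty)$ and $H_q$ does have a zero in $(1,q)$, so such a $c_0$ exists; $T$ is locally finite (finite intersection with every bounded interval). Hilbert spaces are complex. For a positive operator $A$, $A^t$ is defined by continuous functional calculus for $t>0$ and $A^0=I$. For a time set $T$ and a family $\mathcal F=(f_i)_{i\in I}$ in $H$, $\mathcal O_T(A,\mathcal F)=\{A^tf_i:t\in T,\ i\in I\}$, regarded as a family indexed by $T\times I$. It is Bessel if there is $b<\infty$ with $\sum_{t\in T}\sum_{i\in I}|\langle x,A^tf_i\rangle|^2\le b\|x\|^2$ for all $x\in H$, and a frame if in addition this sum is $\ge a\|x\|^2$ for some $a>0$ and all $x\in H$. A positive diagonal operator is one of the form $De_k=\lambda_ke_k$ for an orthonormal basis $(e_k)$ and $\lambda_k\ge0$. A (singly generated) positive diagonal Carleson frame is a frame of the form $\{D^nb\}_{n\ge0}$ where $De_k=\lambda_ke_k$ for an orthonormal basis $(e_k)$, $0<\lambda_k<1$, and $\inf_k\prod_{j\ne k}\left|\frac{\lambda_k-\lambda_j}{1-\lambda_k\lambda_j}\right|>0$; its $T$-sampled orbit is $\{D^tb\}_{t\in T}$. *)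

(* Defs.v *)
From HB Require Import structures.
From mathcomp Require Import all_boot all_order all_algebra sesquilinear.
From mathcomp Require Import complex.
From mathcomp Require Import all_classical all_reals all_analysis.

Set Implicit Arguments.
Unset Strict Implicit.
Unset Printing Implicit Defensive.

Import Order.TTheory GRing.Theory Num.Theory.
Import numFieldNormedType.Exports.

Local Open Scope classical_set_scope.
Local Open Scope complex_scope.
Local Open Scope ring_scope.

(* A complex Hilbert space.  The norm of a normed module over R[i] takes its
   values in R[i] (they are real and nonnegative there); they are brought back
   to R with [complex.Re] below. *)
Record hilbertSpace (R : realType) := HilbertSpace {
  hcarrier :> completeNormedModType R[i];
  inner : {dot hcarrier for Num.conj};
  innerxx : forall x : hcarrier, inner x x = `|x| ^+ 2
}.

Arguments inner {R h}.

Section Operators.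
Variables (R : realType) (H : hilbertSpace R).
Implicit Types (A D : {linear H -> H}) (B : H -> H).

Definition separable : Prop := exists2 S : set H, countable S & dense S.

Definition lin_span (I : choiceType) (e : I -> H) : set H :=
  [set x | exists (s : seq I) (c : I -> R[i]), x = \sum_(i <- s) c i *: e i].

Definition orthonormal_basis (I : choiceType) (e : I -> H) : Prop :=
  (forall i j, inner (e i) (e j) = (i == j)%:R) /\ dense (lin_span e).

Definition positive_diagonal A : Prop :=
  continuous A /\
  exists (I : choiceType) (e : I -> H) (lambda : I -> R),
    [/\ orthonormal_basis e, forall i, 0 <= lambda i
      & forall i, A (e i) = (lambda i)%:C *: e i].

Definition contractive A : Prop := forall x, `|A x| <= `|x|.

(* The eigenspace [ker (A - z)] has dimension [m]: it has a basis [v] of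
   length [m]. *)
Definition eigenspace_dim A (z : R[i]) (m : nat) : Prop :=
  exists v : 'I_m -> H,
    (forall c : 'I_m -> R[i],
        \sum_(i < m) c i *: v i = 0 -> forall i, c i = 0) /\
    (forall x, A x = z *: x <->
       exists c : 'I_m -> R[i], x = \sum_(i < m) c i *: v i).

Definition is_eigenvalue A (z : R[i]) : Prop :=
  exists2 x : H, x != 0 & A x = z *: x.

Definition spectrum A : set R[i] :=
  [set z | ~ exists B : {linear H -> H},
      [/\ continuous B, forall x, B (A x - z *: x) = x
        & forall x, A (B x) - z *: B x = x]].

Definition poly_op (p : {poly R}) A : H -> H :=
  fun x => \sum_(i < size p) (p`_i)%:C *: iter i A x.

(* Continuous functional calculus of a positive operator, whose spectrum is
   contained in [0, +oo[ : [f(A)] is the limit in operator norm of [p_n(A)], for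
   polynomials [p_n] converging to [f] uniformly on the spectrum.  For [f]
   continuous on the spectrum such [p_n] exist, and the limit does not depend
   on them. *)
Definition is_fun_calc A (f : R -> R) B : Prop :=
  exists p : nat -> {poly R},
    (forall eps : R, 0 < eps -> \forall n \near \oo,
       forall s : R, spectrum A s%:C -> `|(p n).[s] - f s| <= eps) /\
    (forall eps : R, 0 < eps -> \forall n \near \oo,
       forall x : H, `|poly_op (p n) A x - B x| <= eps%:C * `|x|).

Definition fun_calc A (f : R -> R) : H -> H :=
  xget (fun=> 0) [set B | is_fun_calc A f B].

Definition op_pow A (t : R) : H -> H :=
  if t == 0 then id else fun_calc A (fun s => s `^ t).

Section Orbits.
Variables (T : set R) (A : {linear H -> H}) (m : nat) (F : 'I_m -> H).

Definition orbit_energy (x : H) : \bar R :=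
  \esum_(t in T)
    (\sum_(i < m) (complex.Re (`|inner x (op_pow A t (F i))| ^+ 2))%:E)%E.

Definition bessel_orbit : Prop :=
  exists b : R, forall x : H,
    (orbit_energy x <= (b * complex.Re (`|x| ^+ 2))%:E)%E.

Definition frame_orbit : Prop :=
  bessel_orbit /\
  exists2 a : R, 0 < a & forall x : H,
    ((a * complex.Re (`|x| ^+ 2))%:E <= orbit_energy x)%E.

End Orbits.

Definition nat_times : set R := range (fun n : nat => n%:R).

Definition min_orbit_generators A (m : nat) : Prop :=
  (exists G : 'I_m -> H, frame_orbit nat_times A G) /\
  (forall (r : nat) (G : 'I_r -> H), frame_orbit nat_times A G -> (m <= r)%N).

Definition carleson_product (lambda : nat -> R) (k : nat) : R :=
  \big[ *%R/1]_(0 <= j <oo | j != k)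
    `|(lambda k - lambda j) / (1 - lambda k * lambda j)|.

Definition carleson_frame D (b : H) : Prop :=
  [/\ continuous D,
      exists (e : nat -> H) (lambda : nat -> R),
        [/\ orthonormal_basis e,
            forall k, D (e k) = (lambda k)%:C *: e k,
            forall k, 0 < lambda k < 1
          & 0 < inf (range (carleson_product lambda))]
    & frame_orbit nat_times D (fun _ : 'I_1 => b)].

End Operators.

Arguments separable {R} H.
Arguments nat_times {R}.

Section TimeSet.
Variable R : realType.
Implicit Types q c : R.

Definition H_term q c (n : int) : R :=
  (-1) ^ n * q `^ (n%:~R / 2) * expR (- (c * q ^ n)).

(* The sum over n in Z, split as n >= 0 and n < 0. *)
Definition H_sum q c : R :=
  limn (series (fun k : nat => H_term q c k%:Z)) +
  limn (series (fun k : nat => H_term q c (- k.+1%:Z))).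

Definition time_block q c (m : nat) : set R :=
  [set c * q ^+ m + l%:R * q ^- (2 * m)
    | l in [set l : nat | (1 <= l)%N /\ l%:R <= q ^+ m]].

Definition time_set q c : set R :=
  [set 0] `|` \bigcup_m time_block q c m.

End TimeSet.

(* Main.v *)
(* The operator is diagonal on the square-summable sequences with values in
   C^m, with eigenvalues exp(-a_k), a_k = 16^-(k+2), each of multiplicity m, and
   the i-th generator has coefficients sqrt(a_k) on the i-th copy of the basis.
   Taking real and imaginary parts of the coordinates, everything reduces to
   the sums of |sum_k u_k sqrt(a_k) exp(-t a_k)|^2 over t, for real u.

   For integer times this is the quadratic form of the Gram matrix
   sqrt(a_j a_k) / (1 - exp(-(a_j + a_k))), whose entries are 1/(4^d + 4^-d),
   d = |j - k|, up to a small error.  It is bounded by Schur's test, and bounded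
   below because it is the Kac-Murdock-Szego matrix 4^-d (which is >= 3/5) minus
   half the identity minus a remainder of norm at most 1/25.

   On the m-th block of T the kernel 16^(m/2) sqrt(a_k) exp(-t a_k) is at most
   4^-|m-k-2|, so Schur's test gives the Bessel bound.  For u_k = (-1)^k, k < N,
   the block values are truncations of the series H(c_0) = 0, which decay
   geometrically away from the two ends: the energy stays bounded while
   the square of the norm of u is N, so there is no lower frame bound.

   Fewer than m vectors do not generate a frame, since some vector of an
   m-dimensional eigenspace is orthogonal to all of them.  The functional
   calculus of A^t is needed only for t = 0 and t >= 1, where s^t is Lipschitz
   on [0, 1] and its Bernstein polynomials converge uniformly. *)
Require Import Defs.
From HB Require Import structures.
From mathcomp Require Import all_boot all_order all_algebra sesquilinear.
From mathcomp Require Import complex.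
From mathcomp Require Import all_classical all_reals all_analysis.
From mathcomp Require Import ring lra zify.

Set Implicit Arguments.
Unset Strict Implicit.
Unset Printing Implicit Defensive.

Import Order.TTheory GRing.Theory Num.Theory.
Import numFieldNormedType.Exports.

Local Open Scope classical_set_scope.
Local Open Scope ring_scope.

(** * Finite quadratic forms *)

Section FiniteForms.
Variable R : realType.
Implicit Types (u v : nat -> R) (w : nat -> nat -> R) (r C : R).

(** The distance |j - k|: one of the two truncated differences is always zero. *)
Definition dst (j k : nat) : nat := (j - k + (k - j))%N.

Lemma dstC j k : dst j k = dst k j. Proof. by rewrite /dst addnC. Qed.

Lemma dstnn j : dst j j = 0%N. Proof. by rewrite /dst subnn. Qed.

Lemma sum_expr_le r n : 0 <= r < 1 -> \sum_(j < n) r ^+ j <= (1 - r)^-1.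
Proof.
move=> /andP[r0 r1]; have r10 : 0 < 1 - r by rewrite subr_gt0.
rewrite -[leRHS]div1r ler_pdivlMr// mulrC.
have -> : (1 - r) * (\sum_(j < n) r ^+ j) = 1 - r ^+ n.
  by rewrite -[RHS]opprB subrX1 -mulNr opprB.
by rewrite gerBl exprn_ge0.
Qed.

(** The bound is the exact value of the sum over all j. Its term r^(k+1) makes the induction on k
    close: shifting j and k together peels off the summand r^(k+1) at j = 0. *)
Lemma sum_expr_dst_le_sharp r n k : 0 <= r < 1 ->
  \sum_(j < n) r ^+ dst j k <= (1 + r - r ^+ k.+1) / (1 - r).
Proof.
move=> r01; move: (r01) => /andP[r0 r1].
have r10 : 0 < 1 - r by rewrite subr_gt0.
elim: k n => [|k IH] n.
  rewrite expr1 addrK div1r; apply: le_trans (sum_expr_le n r01).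
  by apply: ler_sum => i _; rewrite /dst subn0 sub0n addn0.
have rk : r ^+ k.+1 <= 1 by rewrite exprn_ile1 // ltW.
have rk0 : 0 <= r ^+ k.+1 by rewrite exprn_ge0.
case: n => [|n].
  by rewrite big_ord0 divr_ge0 ?(ltW r10)// exprS; nra.
rewrite big_ord_recl {1}/dst sub0n add0n subn0 /=.
have /(lerD (lexx (r ^+ k.+1))) H := IH n.
apply: le_trans H _.
rewrite -[leRHS](subrK ((1 + r - r ^+ k.+1) / (1 - r))) lerD2r -mulrBl.
rewrite ler_pdivlMr// [r ^+ k.+2]exprS; lra.
Qed.

Lemma sum_expr_dst_le r n k : 0 <= r < 1 ->
  \sum_(j < n) r ^+ dst j k <= (1 + r) / (1 - r).
Proof.
move=> r01; move: (r01) => /andP[r0 r1].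
apply: le_trans (sum_expr_dst_le_sharp n k r01) _.
by rewrite ler_pM2r ?invr_gt0 ?subr_gt0// gerBl exprn_ge0.
Qed.

(** Schur's test for a symmetric kernel: |v_j| |v_k| is at most the mean of the two squares, and by
    symmetry both halves are controlled by column sums. *)
Lemma schur_form (n : nat) w v C :
  (forall j k, 0 <= w j k) -> (forall j k, w j k = w k j) ->
  (forall k, (k < n)%N -> \sum_(j < n) w j k <= C) ->
  \sum_(j < n) \sum_(k < n) w j k * (`|v j| * `|v k|) <=
  C * \sum_(k < n) v k ^+ 2.
Proof.
move=> w0 ws wC.
apply: (@le_trans _ _ (\sum_(j < n) \sum_(k < n)
    (w j k * v j ^+ 2 / 2 + w j k * v k ^+ 2 / 2))).
  apply: ler_sum => j _; apply: ler_sum => k _.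
  rewrite -(real_normK (num_real (v j))) -(real_normK (num_real (v k))).
  have := w0 j k; set x := `|v j|; set y := `|v k| => wjk.
  have := mulr_ge0 wjk (sqr_ge0 (x - y)); nra.
under eq_bigr do rewrite big_split /=.
rewrite big_split /= [X in _ + X]exchange_big /=.
have E : \sum_(j < n) \sum_(i < n) w i j * v j ^+ 2 / 2 =
         \sum_(j < n) \sum_(i < n) w j i * v j ^+ 2 / 2.
  by apply: eq_bigr => j _; apply: eq_bigr => i _; rewrite ws.
rewrite -E -big_split mulr_sumr /=; apply: ler_sum => k _.
rewrite -big_split /=.
under eq_bigr do rewrite -splitr.
by rewrite -mulr_suml ler_wpM2r ?sqr_ge0// wC.
Qed.

(** Cauchy-Schwarz for the weights p, by induction; the cross term is absorbed because the sum of
    p_i (v_i - v_n)^2 is nonnegative. *)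
Lemma weighted_CS (n : nat) (p v : nat -> R) :
  (forall k, 0 <= p k) ->
  (\sum_(k < n) p k * v k) ^+ 2 <=
  (\sum_(k < n) p k) * \sum_(k < n) p k * v k ^+ 2.
Proof.
move=> p0; elim: n => [|n IH]; first by rewrite !big_ord0 mul0r expr0n.
rewrite !big_ord_recr /=.
set s := \sum_(i < n) p i * v i in IH *; set P := \sum_(i < n) p i in IH *.
set Q := \sum_(i < n) p i * v i ^+ 2 in IH *.
have P0 : 0 <= P by apply: sumr_ge0.
have Q0 : 0 <= Q by apply: sumr_ge0 => i _; rewrite mulr_ge0 ?sqr_ge0.
have key : 2 * s * v n <= Q + P * v n ^+ 2.
  have : 0 <= \sum_(i < n) p i * (v i - v n) ^+ 2.
    by apply: sumr_ge0 => i _; rewrite mulr_ge0 ?sqr_ge0.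
  have -> : \sum_(i < n) p i * (v i - v n) ^+ 2 =
            Q - 2 * s * v n + P * v n ^+ 2.
    rewrite /Q /s /P mulr_sumr !mulr_suml -sumrB -big_split /=.
    by apply: eq_bigr => i _; ring.
  lra.
have := p0 n; move: (p n) (v n) key => c x key c0.
by have := ler_wpM2l c0 key; nra.
Qed.

(** Schur's test for a rectangular kernel: the row sums come out of [weighted_CS], the column sums
    appear after exchanging the two summations. *)
Lemma schur_rect (M n : nat) w v (C1 C2 : R) :
  (forall j k, 0 <= w j k) -> 0 <= C1 ->
  (forall m, (m < M)%N -> \sum_(k < n) w m k <= C1) ->
  (forall k, (k < n)%N -> \sum_(m < M) w m k <= C2) ->
  \sum_(m < M) (\sum_(k < n) w m k * v k) ^+ 2 <=
  C1 * C2 * \sum_(k < n) v k ^+ 2.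
Proof.
move=> w0 C10 wC1 wC2.
apply: (@le_trans _ _ (\sum_(m < M) C1 * \sum_(k < n) w m k * v k ^+ 2)).
  apply: ler_sum => m _; apply: le_trans (weighted_CS _ _ (w0 m)) _.
  apply: ler_wpM2r (wC1 _ _) => //.
  by apply: sumr_ge0 => i _; rewrite mulr_ge0 ?sqr_ge0.
rewrite -mulr_sumr -mulrA ler_wpM2l// exchange_big mulr_sumr /=.
apply: ler_sum => k _; rewrite -mulr_suml ler_wpM2r ?sqr_ge0//.
exact: wC2.
Qed.

(* The Kac-Murdock-Szego matrix of ratio r = 1/4 has smallest symbol value
   (1 - r) / (1 + r) = 3/5; the slack 4 z^2 in the geometric running sum z
   makes the estimate inductive. *)
Lemma kms_form_ge n v :
  3 / 5 * (\sum_(k < n) v k ^+ 2) +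
    4 * (\sum_(j < n) 4^-1 ^+ (n - j) * v j) ^+ 2 <=
  \sum_(j < n) \sum_(k < n) 4^-1 ^+ dst j k * (v j * v k).
Proof.
elim: n => [|n IH]; first by rewrite !big_ord0; lra.
rewrite [leRHS]big_ord_recr /=.
under [X in _ <= X + _]eq_bigr => j _ do rewrite big_ord_recr /=.
rewrite big_split /= !big_ord_recr /= subSnn expr1 dstnn expr0 mul1r.
pose z := \sum_(j < n) 4^-1 ^+ (n - j) * v j.
have -> : \sum_(j < n) 4^-1 ^+ dst j n * (v j * v n) = z * v n.
  rewrite mulr_suml; apply: eq_bigr => j _.
  by rewrite mulrA /dst (eqP (ltnW (ltn_ord j) : (j - n == 0)%N)).
have -> : \sum_(j < n) 4^-1 ^+ dst n j * (v n * v j) = z * v n.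
  rewrite mulr_suml; apply: eq_bigr => j _.
  by rewrite mulrCA mulrC /dst (eqP (ltnW (ltn_ord j) : (j - n == 0)%N)) addn0.
have -> : \sum_(j < n) 4^-1 ^+ (n.+1 - j) * v j = 4^-1 * z.
  rewrite mulr_sumr; apply: eq_bigr => j _.
  by rewrite subSn ?(ltnW (ltn_ord j))// exprS mulrA.
rewrite -/z in IH.
(* With the induction hypothesis, what remains to be nonnegative is exactly 3/20 (v_n + 5z)^2; this
   fixes the slack constant 4. *)
have := sqr_ge0 (v n + 5 * z); nra.
Qed.

End FiniteForms.

(** * The exponential kernel: Gram matrix of integer times and block estimates *)

Section Kernel.
Variable R : realType.
Implicit Types (u : nat -> R) (t : R).

(* The eigenvalues are [expR (- rate k)] and the generator has coefficients
   [wt k], so that [wt k ^ 2 = rate k] is comparable to [1 - expR (- rate k) ^ 2].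
   The index starts at 2 because only for small rates is the remainder in
   [gram_near_kms] small enough for [gram_form_ge]. *)
Definition rate (k : nat) : R := 16^-1 ^+ k.+2.
Definition wt (k : nat) : R := 4^-1 ^+ k.+2.
Definition ev t k : R := wt k * expR (- (t * rate k)).
(** The value of the geometric series over n of [ev n%:R j * ev n%:R k]. *)
Definition gram (j k : nat) : R :=
  wt j * wt k / (1 - expR (- (rate j + rate k))).

Lemma wt_gt0 k : 0 < wt k. Proof. by rewrite exprn_gt0// invr_gt0. Qed.
Lemma rate_gt0 k : 0 < rate k. Proof. by rewrite exprn_gt0// invr_gt0. Qed.

Lemma rateE k : rate k = wt k ^+ 2.
Proof. by rewrite /rate /wt exprAC; congr (_ ^+ _); lra. Qed.

Lemma wt_le k : wt k <= 16^-1.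
Proof.
have -> : 16^-1 = 4^-1 ^+ 2 :> R by lra.
by rewrite /wt ler_wiXn2l//; lra.
Qed.

Lemma rate_le k : rate k <= 256^-1.
Proof. by rewrite rateE; have := wt_le k; have := wt_gt0 k; nra. Qed.

Lemma expRN_le1 (x : R) : 0 <= x -> expR (- x) <= 1.
Proof. by move=> x0; rewrite expR_le1 oppr_le0. Qed.

Lemma expRN_leV (x : R) : 0 < x -> expR (- x) <= x^-1.
Proof.
move=> x0; rewrite expRN lef_pV2 ?posrE ?expR_gt0//.
by apply: le_trans (expR_ge1Dx x); lra.
Qed.

(** Both halves come from 1 - s <= exp(-s) <= 1/(1 + s). They replace the Gram matrix by a Cauchy
    matrix with an error of at most [wt j * wt k]. *)
Lemma inv_1BexpR (s : R) : 0 < s -> s^-1 <= (1 - expR (- s))^-1 <= s^-1 + 1.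
Proof.
move=> s0; have e1 : 0 < 1 - expR (- s) by rewrite subr_gt0 expR_lt1 oppr_lt0.
apply/andP; split.
  by rewrite lef_pV2 ?posrE//; have := expR_ge1Dx (- s); lra.
have -> : s^-1 + 1 = (s / (1 + s))^-1 by field; lra.
rewrite lef_pV2 ?posrE// ?divr_gt0//; last lra.
have s1 : 0 < 1 + s by lra.
rewrite expRN; have : (expR s)^-1 <= (1 + s)^-1.
  by rewrite lef_pV2 ?posrE ?expR_gt0// expR_ge1Dx.
have -> : s / (1 + s) = 1 - (1 + s)^-1 by field; lra.
lra.
Qed.

(** The geometric choice of the rates makes the Cauchy matrix Toeplitz: with x = 4^-d the weights
    are w and wx, and w^2 cancels from w^2 x / (w^2 + w^2 x^2). *)
Lemma cauchy_dst j k :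
  wt j * wt k / (rate j + rate k) = 4^-1 ^+ dst j k / (1 + 16^-1 ^+ dst j k).
Proof.
wlog jk : j k / (j <= k)%N => [H|].
  case: (leqP j k) => [/H//|/ltnW/H E].
  by rewrite dstC -E [wt k * _]mulrC [rate k + _]addrC.
rewrite !rateE -(subnKC jk) /dst; set d := (k - j)%N.
have -> : (j - (j + d) + (j + d - j) = d)%N by clearbody d; lia.
have -> : wt (j + d) = wt j * 4^-1 ^+ d by rewrite /wt -exprD addSn addSn.
have -> : 16^-1 = 4^-1 ^+ 2 :> R by lra.
rewrite exprAC; set x := 4^-1 ^+ d; have x0 : 0 < x by rewrite exprn_gt0// invr_gt0.
have w0 := wt_gt0 j; field.
by apply/andP; split; apply: lt0r_neq0; nra.
Qed.

Lemma gram_bounds j k :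
  4^-1 ^+ dst j k / (1 + 16^-1 ^+ dst j k) <= gram j k <=
  4^-1 ^+ dst j k / (1 + 16^-1 ^+ dst j k) + wt j * wt k.
Proof.
have w0 : 0 <= wt j * wt k by rewrite mulr_ge0// ltW// wt_gt0.
rewrite -cauchy_dst /gram.
have := inv_1BexpR (addr_gt0 (rate_gt0 j) (rate_gt0 k)) => /andP[l h].
by rewrite ler_wpM2l//=
  -[leRHS](_ : wt j * wt k * ((rate j + rate k)^-1 + 1) = _) ?ler_wpM2l// mulrDr mulr1.
Qed.

Lemma gram_ge0 j k : 0 <= gram j k.
Proof.
have /andP[+ _] := gram_bounds j k; apply: le_trans.
by rewrite divr_ge0 ?addr_ge0 ?exprn_ge0// invr_ge0.
Qed.

Lemma wtM_le j k : wt j * wt k <= 4^-1 ^+ dst j k.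
Proof.
by rewrite /wt -exprD; apply: ler_wiXn2l; rewrite /dst; [lra|lra|lia].
Qed.

Lemma gram_le j k : gram j k <= 2 * 4^-1 ^+ dst j k.
Proof.
have /andP[_ +] := gram_bounds j k.
have d0 : 0 <= 4^-1 ^+ dst j k :> R by rewrite exprn_ge0// invr_ge0.
have : 4^-1 ^+ dst j k / (1 + 16^-1 ^+ dst j k) <= 4^-1 ^+ dst j k :> R.
  rewrite ler_pdivrMr; last by rewrite ltr_pwDl// exprn_ge0// invr_ge0.
  by rewrite ler_peMr// lerDl exprn_ge0// invr_ge0.
have := wtM_le j k; lra.
Qed.

(* [1/(4^d + 4^-d)] differs from [4^-d] by at most [64^-d], and by exactly
   [1/2] for [d = 0]. *)
Lemma gram_near_kms j k :
  `|gram j k - (4^-1 ^+ dst j k - (j == k)%:R / 2)| <=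
  (64^-1 ^+ dst j k - (j == k)%:R) + wt j * wt k.
Proof.
have w0 : 0 < wt j * wt k by rewrite mulr_gt0// wt_gt0.
have := gram_bounds j k.
case: (eqVneq j k) w0 => [->|jk] w0.
  rewrite dstnn !expr0 mulr1n subrr add0r => /andP[H1 H2].
  have E : 1 / (1 + 1) = 2^-1 :> R by field.
  by rewrite E in H1 H2; rewrite ler_norml; apply/andP; split; lra.
have d0 : (0 < dst j k)%N by rewrite /dst; move: jk; rewrite neq_ltn => /orP[]; lia.
rewrite /= mul0r !subr0.
have -> : 16^-1 = 4^-1 ^+ 2 :> R by lra.
have -> : 64^-1 = 4^-1 ^+ 3 :> R by lra.
rewrite ![_ ^+ _ ^+ dst j k]exprAC; set x := 4^-1 ^+ dst j k.
have x0 : 0 < x by rewrite exprn_gt0// invr_gt0.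
have x20 : 0 < 1 + x ^+ 2 by rewrite ltr_pwDl// exprn_ge0// ltW.
have -> : x / (1 + x ^+ 2) = x - x ^+ 3 / (1 + x ^+ 2) by field; rewrite lt0r_neq0.
have : 0 <= x ^+ 3 / (1 + x ^+ 2) <= x ^+ 3.
  rewrite divr_ge0 ?exprn_ge0 ?(ltW x20) ?(ltW x0)//= ler_pdivrMr//.
  by rewrite ler_peMr ?exprn_ge0 ?(ltW x0)// lerDl exprn_ge0// ltW.
rewrite ler_norml; lra.
Qed.

Lemma sum_wt_le n : \sum_(k < n) wt k <= 12^-1.
Proof.
rewrite /wt; under eq_bigr do rewrite !exprS mulrA.
rewrite -mulr_sumr; have := @sum_expr_le R 4^-1 n;
  rewrite (_ : (1 - 4^-1)^-1 = 4 / 3 :> R); last by field.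
move=> H; have {}H : \sum_(j < n) 4^-1 ^+ j <= 4 / 3 :> R by apply: H; lra.
lra.
Qed.


Lemma sum_dst_le (r : R) n k (D : R) : 0 <= r < 1 -> 1 + r <= D * (1 - r) ->
  \sum_(j < n) r ^+ dst j k <= D.
Proof.
move=> r01 rD; apply: le_trans (sum_expr_dst_le _ _ r01) _.
by rewrite ler_pdivrMr// subr_gt0; case/andP: r01.
Qed.

Lemma expr_ge0V (c : R) n : 0 <= c -> 0 <= c^-1 ^+ n.
Proof. by move=> c0; rewrite exprn_ge0// invr_ge0. Qed.

(** The constant is 3/5 - 1/2 - 1/25 = 3/50, rounded down to 1/20. *)
Lemma gram_form_ge n u :
  20^-1 * (\sum_(k < n) u k ^+ 2) <=
  \sum_(j < n) \sum_(k < n) gram j k * (u j * u k).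
Proof.
pose S := \sum_(k < n) u k ^+ 2; rewrite -/S.
have S0 : 0 <= S by apply: sumr_ge0 => i _; rewrite sqr_ge0.
pose K := \sum_(j < n) \sum_(k < n) 4^-1 ^+ dst j k * (u j * u k).
have K1 : 3 / 5 * S <= K.
  apply: le_trans (kms_form_ge n u).
  by rewrite lerDl mulr_ge0// sqr_ge0.
pose w (j k : nat) : R := (64^-1 ^+ dst j k - (j == k)%:R) + wt j * wt k.
have w0 j k : 0 <= w j k by apply: le_trans (gram_near_kms j k).
have ws j k : w j k = w k j by rewrite /w dstC eq_sym [wt j * _]mulrC.
have wC k : (k < n)%N -> \sum_(j < n) w j k <= 25^-1.
  (* The column sums are at most (65/63 - 1) + (1/16)(1/12), which is below 1/25. *)
  move=> kn; rewrite big_split sumrB /=.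
  have -> : \sum_(i < n) (i == k :> nat)%:R = 1 :> R.
    rewrite (bigD1 (Ordinal kn)) //= eqxx big1 ?addr0// => i /eqP ik.
    by case: eqP => // e; case: ik; apply: val_inj.
  have := @sum_dst_le 64^-1 n k (65 / 63) ltac:(lra) ltac:(lra).
  rewrite -mulr_suml; have := sum_wt_le n; have := wt_le k; have := wt_gt0 k.
  have : 0 <= \sum_(i < n) wt i by apply: sumr_ge0 => i _; rewrite ltW ?wt_gt0.
  nra.
have := @schur_form R n w u 25^-1 w0 ws wC; rewrite -/S.
set W := \sum_(j < n) _ => WS.
have : K - S / 2 - W <= \sum_(j < n) \sum_(k < n) gram j k * (u j * u k).
  have -> : S = \sum_(j < n) \sum_(k < n) (j == k :> nat)%:R * (u j * u k).
    apply: eq_bigr => j _; rewrite (bigD1 j)//= eqxx mul1r big1 ?addr0 ?expr2//.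
    move=> i /eqP ij; case: eqP; rewrite ?mul0r// => e.
    by case: ij; apply: val_inj.
  rewrite /K /W mulr_suml -!sumrB; apply: ler_sum => j _.
  rewrite mulr_suml -!sumrB; apply: ler_sum => k _.
  have := gram_near_kms j k; rewrite -/(w j k).
  have := w0 j k; set g := gram _ _; set d := _ ^+ _; set b := _%:R.
  move=> w0' H; rewrite -normrM.
  have : `|(g - (d - b / 2)) * (u j * u k)| <= w j k * `|u j * u k|.
    by rewrite normrM ler_wpM2r.
  by rewrite ler_norml => /andP[+ _]; lra.
lra.
Qed.

Lemma evM_nat n j k :
  ev n%:R j * ev n%:R k = wt j * wt k * expR (- (rate j + rate k)) ^+ n.
Proof.
rewrite /ev mulrACA -expRD -expRM_natl; congr (_ * expR _); ring.
Qed.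

Lemma sqr_sumE n (c : 'I_n -> R) :
  (\sum_(k < n) c k) ^+ 2 = \sum_(j < n) \sum_(k < n) c j * c k.
Proof.
by rewrite expr2 mulr_suml; apply: eq_bigr => j _; rewrite mulr_sumr.
Qed.

(** Stopping after M times multiplies each Gram entry by a factor in [0, 1] that tends to 1. The
    same formula therefore gives an upper bound for every M and the lower bound in the limit. *)
Lemma nat_energyE u N M :
  \sum_(n < M) (\sum_(k < N) u k * ev n%:R k) ^+ 2 =
  \sum_(j < N) \sum_(k < N) gram j k * (u j * u k) *
      (1 - expR (- (rate j + rate k)) ^+ M).
Proof.
under eq_bigr do rewrite sqr_sumE.
rewrite exchange_big; apply: eq_bigr => j _ /=.
rewrite exchange_big; apply: eq_bigr => k _ /=.
under eq_bigr do rewrite mulrACA evM_nat mulrA.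
rewrite -mulr_sumr /gram; set x := expR _.
have x1 : 1 - x != 0.
  by rewrite lt0r_neq0// subr_gt0 expR_lt1 oppr_lt0 addr_gt0 ?rate_gt0.
have -> : \sum_(i < M) x ^+ i = (1 - x ^+ M) / (1 - x).
  by apply: (mulIf x1); rewrite divfK// -[RHS]opprB subrX1 -mulNr opprB mulrC.
by field.
Qed.

Lemma nat_energy_le u N M :
  \sum_(n < M) (\sum_(k < N) u k * ev n%:R k) ^+ 2 <=
  4 * \sum_(k < N) u k ^+ 2.
Proof.
rewrite nat_energyE.
have d0 j k : 0 <= 2 * 4^-1 ^+ dst j k :> R.
  by rewrite mulr_ge0// expr_ge0V.
apply: (@le_trans _ _ (\sum_(j < N) \sum_(k < N)
   2 * 4^-1 ^+ dst j k * (`|u j| * `|u k|))).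
  apply: ler_sum => j _; apply: ler_sum => k _.
  have x1 : expR (- (rate j + rate k)) <= 1.
    by rewrite expR_le1 oppr_le0 addr_ge0// ltW// rate_gt0.
  have x0 := expR_ge0 (- (rate j + rate k)).
  have xM1 := exprn_ile1 M x0 x1; have xM0 := exprn_ge0 M x0.
  rewrite -normrM; apply: le_trans (ler_norm _) _.
  rewrite [leLHS]normrM -[leRHS]mulr1; apply: ler_pM => //; last first.
    by rewrite ger0_norm; lra.
  by rewrite [leLHS]normrM ger0_norm ?gram_ge0// ler_wpM2r// gram_le.
(* The column sums are at most 2 * 5/3 = 10/3. *)
apply: (@schur_form R N (fun j k => 2 * 4^-1 ^+ dst j k) u 4) => // [j k|k _];
  first by rewrite dstC.
rewrite -mulr_sumr; have := @sum_dst_le 4^-1 N k (5 / 3) ltac:(lra) ltac:(lra).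
lra.
Qed.

Lemma cvg_sumr (n : nat) (f : 'I_n -> nat -> R) (l : 'I_n -> R) :
  (forall i, f i M @[M --> \oo] --> l i) ->
  \sum_(i < n) f i M @[M --> \oo] --> \sum_(i < n) l i.
Proof. by move=> fl; apply: cvg_big => //; apply: add_continuous. Qed.

Lemma nat_energy_cvg u N :
  \sum_(n < M) (\sum_(k < N) u k * ev n%:R k) ^+ 2 @[M --> \oo] -->
  \sum_(j < N) \sum_(k < N) gram j k * (u j * u k).
Proof.
under eq_cvg do rewrite nat_energyE.
apply: cvg_sumr => j; apply: cvg_sumr => k.
rewrite -[X in _ --> X]mulr1; apply: cvgM; first exact: cvg_cst.
rewrite -[X in _ --> X]subr0; apply: cvgB; first exact: cvg_cst.
apply: cvg_expr; rewrite ger0_norm ?expR_ge0// expR_lt1 oppr_lt0.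
by rewrite addr_gt0 ?rate_gt0.
Qed.

Lemma nat_energy_ge u N B :
  (forall M, \sum_(n < M) (\sum_(k < N) u k * ev n%:R k) ^+ 2 <= B) ->
  20^-1 * (\sum_(k < N) u k ^+ 2) <= B.
Proof.
move=> uB; apply: le_trans (gram_form_ge N u) _.
have c := @nat_energy_cvg u N.
rewrite -(cvg_lim _ c)//; apply: limr_le; first by apply/cvg_ex; eexists; exact: c.
by near=> M; apply: uB.
Unshelve. all: by end_near. Qed.

(* With [y = 16^m * rate k = 16^(m-k-2)] this is
   [sqrt y * expR (- y) <= min (sqrt y) (sqrt y)^-1]. *)
Lemma block_kernel_le m k t : 16 ^+ m <= t ->
  4 ^+ m * ev t k <= 4^-1 ^+ dst m k.+2.
Proof.
move=> mt; rewrite /ev mulrA.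
have tr : 16 ^+ m * rate k <= t * rate k by rewrite ler_wpM2r// ltW// rate_gt0.
have y0 : 0 < 16 ^+ m * rate k by rewrite mulr_gt0 ?rate_gt0// exprn_gt0.
have e : expR (- (t * rate k)) <= expR (- (16 ^+ m * rate k)).
  by rewrite ler_expR lerN2.
have w0 : 0 <= 4 ^+ m * wt k by rewrite mulr_ge0 ?exprn_ge0// ltW// wt_gt0.
apply: le_trans (ler_wpM2l w0 e) _.
have e1 := expRN_le1 (ltW y0); have eV := expRN_leV y0.
case: (leqP m k.+2) => mk.
  apply: le_trans (ler_wpM2l w0 e1) _; rewrite mulr1 /dst (eqP (mk : (m - k.+2 == 0)%N)).
  rewrite add0n /wt -{1}(subnK mk) exprD mulrCA -exprMn mulfV// expr1n mulr1 //.
apply: le_trans (ler_wpM2l w0 eV) _.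
rewrite /dst (eqP (ltnW mk : (k.+2 - m == 0)%N)) addn0 /wt /rate.
have km := ltnW mk.
have -> : m = (m - k.+2 + k.+2)%N by rewrite subnK.
rewrite addnK; set d := (m - k.+2)%N; rewrite !exprD.
have -> : 16 = 4 ^+ 2 :> R by lra.
rewrite -exprVn -!exprM ![(2 * _)%N]mulnC !exprM !exprVn.
set x := 4 ^+ d; set z := 4 ^+ k.+2.
have x0 : 0 < x by rewrite exprn_gt0.
have z0 : 0 < z by rewrite exprn_gt0.
rewrite le_eqVlt; apply/orP; left; apply/eqP; field.
by rewrite !lt0r_neq0.
Qed.

Lemma ev_ge0 t k : 0 <= ev t k.
Proof. by rewrite mulr_ge0 ?expR_ge0// ltW ?wt_gt0. Qed.

Lemma ev_anti t t' k : t <= t' -> ev t' k <= ev t k.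
Proof.
move=> tt; rewrite /ev ler_wpM2l ?(ltW (wt_gt0 _))//.
by rewrite ler_expR lerN2 ler_wpM2r// ltW// rate_gt0.
Qed.

Lemma ev0 k : ev 0 k = wt k.
Proof. by rewrite /ev mul0r oppr0 expR0 mulr1. Qed.

Lemma zero_energy_le u N :
  (\sum_(k < N) u k * ev 0 k) ^+ 2 <= \sum_(k < N) u k ^+ 2.
Proof.
under eq_bigr do rewrite ev0 mulrC.
apply: le_trans (weighted_CS _ _ (fun k => ltW (wt_gt0 k))) _.
have S0 : 0 <= \sum_(k < N) wt k by apply: sumr_ge0 => i _; rewrite ltW ?wt_gt0.
rewrite -[leRHS]mul1r; apply: ler_pM => //.
- by apply: sumr_ge0 => i _; rewrite mulr_ge0 ?sqr_ge0// ltW ?wt_gt0.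
- by have := sum_wt_le N; lra.
- apply: ler_sum => i _; rewrite ler_piMl ?sqr_ge0//.
  by have := wt_le i; lra.
Qed.

Lemma sum_dst_shift_le n k :
  \sum_(j < n) 4^-1 ^+ dst k j.+2 <= 5 / 3 :> R.
Proof.
(* The shifted sum is a sum over n + 2 indices without its first two terms, which are
   nonnegative. *)
have := @sum_dst_le 4^-1 n.+2 k (5 / 3) ltac:(lra) ltac:(lra).
rewrite !big_ord_recl /=; apply: le_trans.
have := @expr_ge0V 4 (dst 0 k) ltac:(lra).
have := @expr_ge0V 4 (dst 1 k) ltac:(lra).
under [X in _ -> _ -> X <= _]eq_bigr do rewrite dstC.
rewrite /bump /=; under [X in _ -> _ -> _ <= _ + (_ + X)]eq_bigr do rewrite !add1n.
lra.
Qed.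

(** The factor 16^m stands for the number of points of block m. Its square root 4^m goes into the
    kernel, and Schur's test with 5/3 for rows and columns gives 25/9 <= 4. *)
Lemma block_energy_le u N M :
  \sum_(m < M) 16 ^+ m * (\sum_(k < N) `|u k| * ev (16 ^+ m) k) ^+ 2 <=
  4 * \sum_(k < N) u k ^+ 2.
Proof.
have -> : \sum_(k < N) u k ^+ 2 = \sum_(k < N) `|u k| ^+ 2.
  by apply: eq_bigr => i _; rewrite real_normK ?num_real.
apply: (@le_trans _ _
  (\sum_(m < M) (\sum_(k < N) 4^-1 ^+ dst m k.+2 * `|u k|) ^+ 2)).
  apply: ler_sum => m _.
  have sqM (x : R) : 16 ^+ m * x ^+ 2 = (4 ^+ m * x) ^+ 2.
    by rewrite exprMn exprAC; congr (_ ^+ _ * _); lra.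
  rewrite sqM ler_sqr ?nnegrE; last first.
  - by apply: sumr_ge0 => k _; rewrite mulr_ge0// expr_ge0V.
  - rewrite mulr_ge0 ?exprn_ge0//; apply: sumr_ge0 => k _.
    by rewrite mulr_ge0// ev_ge0.
  rewrite mulr_sumr; apply: ler_sum => k _.
  by rewrite mulrCA mulrC ler_wpM2r// block_kernel_le.
apply: le_trans (@schur_rect R M N (fun m k => 4^-1 ^+ dst m k.+2)
  (fun k => `|u k|) (5 / 3) (5 / 3) _ _ _ _) _ => //.
- by move=> m _; apply: sum_dst_shift_le.
- by move=> k _; apply: sum_dst_le; lra.
- by apply: ler_wpM2r; [apply: sumr_ge0 => i _; rewrite sqr_ge0|lra].
Qed.

End Kernel.

Arguments rate {R}.
Arguments wt {R}.
Arguments gram {R}.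

(** * The alternating sequence and the zero of H *)

Section Alternating.
Variable R : realType.
Implicit Types (u : nat -> R) (t c : R).

Lemma geometric_tail u (C : R) n :
  (forall k, `|u k| <= C * 4^-1 ^+ k) ->
  cvgn (series u) /\
  `|limn (series u) - series u n| <= 4 / 3 * C * 4^-1 ^+ n.
Proof.
move=> uC.
have q1 : `|4^-1| < 1 :> R by rewrite ger0_norm; lra.
have C0 : 0 <= C.
  by have := uC 0%N; rewrite expr0 mulr1; apply: le_trans.
have cu : cvgn (series u).
  apply: normed_cvg; apply: (@series_le_cvg R (fun k => `|u k|)
    (geometric C 4^-1)) => //; last exact: is_cvg_geometric_series.
  by move=> k; rewrite /geometric/= mulr_ge0// expr_ge0V.
split=> //.
have cn : `|series u k - series u n| @[k --> \oo] -->
          `|limn (series u) - series u n|.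
  by apply: cvg_norm; apply: cvgB => //; exact: cvg_cst.
rewrite -(cvg_lim _ cn)//; apply: limr_le; first by apply/cvg_ex; eexists; exact: cn.
exists n => // k /= nk; rewrite /series /= -(subnKC nk).
rewrite (big_cat_nat (leq0n n) (leq_addr _ _))/= addrAC subrr add0r.
apply: le_trans (ler_norm_sum _ _ _) _.
rewrite -{1}[n]add0n big_addn addKn big_mkord.
apply: (@le_trans _ _ (\sum_(i < k - n) C * 4^-1 ^+ n * 4^-1 ^+ i)).
  apply: ler_sum => i _; apply: le_trans (uC _) _.
  by rewrite -mulrA -exprD addnC.
rewrite -mulr_sumr [leRHS]mulrAC mulrC -mulrA [leRHS]mulrC -mulrA.
rewrite [leRHS]mulrC.
have := @sum_expr_le R 4^-1 (k - n).
rewrite (_ : (1 - 4^-1)^-1 = 4 / 3 :> R); last by field.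
move=> H; have {}H := H ltac:(lra).
by have := ler_wpM2l (mulr_ge0 C0 (@expr_ge0V R 4 n ltac:(lra))) H; lra.
Qed.

Lemma H_termE c (n : int) :
  H_term 16%:R c n = (-1) ^ n * 4 ^ n * expR (- (c * 16 ^ n)).
Proof.
rewrite /H_term; congr (_ * _ * _).
rewrite mulrC powRrM powR12_sqrt//.
have -> : 16%:R = 4 ^+ 2 :> R by ring.
by rewrite sqrtr_sqr ger0_norm// powR_intmul.
Qed.

(** The inequality exp(-y) <= 1/y at y = 16^n turns the growth 4^n into decay 4^-n. For negative
    exponents the power of 4 decays by itself. *)
Lemma H_term_pos_le c (n : nat) : 1 <= c ->
  `|H_term 16%:R c n%:Z| <= 4^-1 ^+ n.
Proof.
move=> c1; rewrite H_termE !normrM.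
rewrite -!exprnP normrX normrN1 expr1n mul1r.
rewrite ger0_norm ?exprn_ge0// ger0_norm ?expR_ge0//.
have y0 : 0 < 16 ^+ n :> R by rewrite exprn_gt0.
have e : expR (- (c * 16 ^+ n)) <= (16 ^+ n)^-1.
  apply: le_trans (expRN_leV y0).
  by rewrite ler_expR lerN2 ler_peMl// ltW.
apply: le_trans (ler_wpM2l (exprn_ge0 _ _) e) _ => //.
have -> : 16 ^+ n = (4 ^+ n) ^+ 2 :> R by rewrite exprAC; congr (_ ^+ _); lra.
rewrite exprVn; have := exprn_gt0 n (ltr0n R 4) => /= z0.
by rewrite expr2 invfM mulrA mulfV ?lt0r_neq0// mul1r.
Qed.

Lemma H_term_neg_le c (n : nat) : 1 <= c ->
  `|H_term 16%:R c (- n%:Z)| <= 4^-1 ^+ n.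
Proof.
move=> c1; rewrite H_termE !normrM.
rewrite -!exprnN !normfV !normrX normrN1 expr1n invr1 mul1r.
rewrite ger0_norm// exprVn ger0_norm ?expR_ge0//.
rewrite ler_piMr ?invr_ge0 ?exprn_ge0// expRN_le1//.
by rewrite mulr_ge0 ?invr_ge0 ?exprn_ge0//; lra.
Qed.

(** The window runs over the exponents from m down to -p. Since the full series vanishes, the window
    is minus its two tails, and [geometric_tail] bounds these by a third of 4^-m and of 4^-p. *)
Lemma H_sum_tails c (m p : nat) : 1 <= c -> H_sum 16%:R c = 0 ->
  `|\sum_(j < m.+1 + p) H_term 16%:R c (m%:Z - j%:Z)| <=
  4^-1 ^+ m + 4^-1 ^+ p.
Proof.
move=> c1 H0.
pose f k := H_term 16%:R c k%:Z; pose g k := H_term 16%:R c (- k.+1%:Z).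
have fC k : `|f k| <= 1 * 4^-1 ^+ k by rewrite mul1r H_term_pos_le.
have gC k : `|g k| <= 4^-1 * 4^-1 ^+ k by rewrite -exprS H_term_neg_le.
have [_ fP] := geometric_tail m.+1 fC.
have [_ gP] := geometric_tail p gC.
have -> : \sum_(j < m.+1 + p) H_term 16%:R c (m%:Z - j%:Z) =
          series f m.+1 + series g p.
  rewrite big_split_ord /=; congr (_ + _); rewrite /series /= big_mkord.
    rewrite (reindex_inj rev_ord_inj) /=; apply: eq_bigr => i _.
    by rewrite /f; congr (H_term _ _ _); have := ltn_ord i; lia.
  by apply: eq_bigr => i _; rewrite /g; congr (H_term _ _ _); lia.
move: H0; rewrite /H_sum -/f -/g => H0.
have x0 := @expr_ge0V R 4 m ltac:(lra).
have y0 := @expr_ge0V R 4 p ltac:(lra).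
rewrite exprS in fP.
move: fP gP; rewrite !ler_norml => /andP[f1 f2] /andP[g1 g2].
by apply/andP; split; lra.
Qed.

(** For m <= N + 1, adding the terms of exponent m and m - 1, left out by the shift by 2, completes
    the window of [H_sum_tails]; the tail and these two terms cost 1 + 1 + 4 = 6 times 4^-m. For
    larger m all exponents are positive and the decay of the terms is enough. *)
Lemma H_block_le c (m N : nat) : 1 <= c -> H_sum 16%:R c = 0 ->
  `|\sum_(k < N) H_term 16%:R c (m%:Z - k.+2%:Z)| <=
  6 * 4^-1 ^+ m + 2 * 4^-1 ^+ dst m N.+1.
Proof.
move=> c1 H0.
have x0 := @expr_ge0V R 4 m ltac:(lra).
have d0 := @expr_ge0V R 4 (dst m N.+1) ltac:(lra).
case: (leqP m N.+1) => mN.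
  have := @H_sum_tails c m (N.+1 - m) c1 H0.
  have -> : (m.+1 + (N.+1 - m) = N.+2)%N by lia.
  rewrite !big_ord_recl /= subr0 /bump /=.
  under eq_bigr do rewrite !add1n.
  set S := \sum_(i < N) _; rewrite add1n.
  have h0 := H_term_pos_le m c1.
  have h1 : `|H_term 16%:R c (m%:Z - 1%:Z)| <= 4 * 4^-1 ^+ m.
    case: m {mN x0 d0 S h0} => [|m].
      rewrite sub0r; apply: le_trans (H_term_neg_le 1 c1) _.
      by rewrite expr0 expr1; lra.
    have -> : m.+1%:Z - 1 = m%:Z by lia.
    apply: le_trans (H_term_pos_le m c1) _.
    by rewrite exprS mulrA mulfV// mul1r.
  rewrite /dst (eqP (mN : (m - N.+1 == 0)%N)) add0n.
  have y0 := @expr_ge0V R 4 (N.+1 - m) ltac:(lra).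
  move: h0 h1; rewrite !ler_norml => /andP[h1 h2] /andP[h3 h4] /andP[h5 h6].
  by apply/andP; split; lra.
apply: le_trans (ler_norm_sum _ _ _) _.
apply: (@le_trans _ _ (\sum_(k < N) 4^-1 ^+ (m - N.+1) * 4^-1 ^+ (N - k.+1))).
  apply: ler_sum => k _; have kN := ltn_ord k.
  have -> : m%:Z - k.+2%:Z = (m - k.+2)%N%:Z by lia.
  apply: le_trans (H_term_pos_le _ c1) _.
  by rewrite -exprD le_eqVlt; apply/orP; left; apply/eqP; congr (_ ^+ _); lia.
rewrite -mulr_sumr (reindex_inj rev_ord_inj) /=.
under eq_bigr => i _ do rewrite subnS subKn ?(ltn_ord i)//.
have H : \sum_(i < N) 4^-1 ^+ i <= 4 / 3 :> R.
  by rewrite (_ : 4 / 3 = (1 - 4^-1)^-1 :> R); [apply: sum_expr_le; lra|field].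
have E : dst m N.+1 = (m - N.+1)%N.
  by rewrite /dst (eqP (ltnW mN : (N.+1 - m == 0)%N)) addn0.
rewrite E in d0 *.
have -> : \sum_(i < N) 4^-1 ^+ i.+1.-1 = \sum_(i < N) 4^-1 ^+ i :> R by [].
by have := ler_wpM2l d0 H; lra.
Qed.

Lemma expz_subn (x : R) (m j : nat) : x != 0 ->
  x ^ (m%:Z - j%:Z) = x ^+ m * x^-1 ^+ j.
Proof. by move=> x0; rewrite expfzDr// -exprnP -exprnN exprVn. Qed.

(** At t = c 16^m the scaled sample of the alternating vector is, up to sign, a window of the series
    H at c. *)
Lemma H_block_ev c m N :
  4 ^+ m * \sum_(k < N) (-1) ^+ k * ev (c * 16 ^+ m) k =
  (-1) ^+ m * \sum_(k < N) H_term 16%:R c (m%:Z - k.+2%:Z).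
Proof.
rewrite !mulr_sumr; apply: eq_bigr => k _.
rewrite H_termE !expz_subn ?oppr_eq0 ?oner_eq0 ?pnatr_eq0//.
rewrite invrN1 /ev /wt /rate [c * (_ * _)]mulrA.
have -> : (-1) ^+ k.+2 = (-1) ^+ k :> R by rewrite !exprS mulrA mulrNN !mul1r.
have p2 : (-1) ^+ m * (-1) ^+ m = 1 :> R by rewrite -expr2 sqrr_sign.
move: (expR _) (4^-1 ^+ _) ((-1) ^+ m) p2 (4 ^+ m) ((-1) ^+ k) => e w p p2 f g.
have -> : p * (p * g * (f * w) * e) = (p * p) * (f * (g * (w * e))) by ring.
by rewrite p2 mul1r.
Qed.

Lemma ev_perturb t d k : 0 <= d ->
  `|ev (t + d) k - ev t k| <= ev t k * (d * rate k).
Proof.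
move=> d0; rewrite /ev mulrDl opprD expRD mulrA.
set y := wt k * _; have y0 : 0 <= y by rewrite mulr_ge0 ?expR_ge0// ltW ?wt_gt0.
rewrite -[X in _ - X]mulr1 -mulrBr normrM ger0_norm// ler_wpM2l//.
have x0 : 0 <= d * rate k by rewrite mulr_ge0// ltW// rate_gt0.
rewrite distrC ger0_norm ?subr_ge0 ?expRN_le1//.
by have := expR_ge1Dx (- (d * rate k)); lra.
Qed.

(** Moving t by at most 16^-m changes the sum by at most 16^-m, which is 4^-m after scaling by 4^m;
    so the 6 of [H_block_le] becomes 7. Squaring with (a + b)^2 <= 2a^2 + 2b^2 produces 98 and 8. *)
Lemma alternating_block c m N t : 1 <= c -> H_sum 16%:R c = 0 ->
  c * 16 ^+ m <= t <= c * 16 ^+ m + 16^-1 ^+ m ->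
  16 ^+ m * (\sum_(k < N) (-1) ^+ k * ev t k) ^+ 2 <=
  98 * 16^-1 ^+ m + 8 * 16^-1 ^+ dst m N.+1.
Proof.
move=> c1 H0 /andP[t1 t2].
pose d := t - c * 16 ^+ m; have d0 : 0 <= d by rewrite subr_ge0.
have d1 : d <= 16^-1 ^+ m by rewrite /d; lra.
have -> : t = c * 16 ^+ m + d by rewrite /d; ring.
set S := \sum_(k < N) _.
have z0 : 0 <= c * 16 ^+ m by rewrite mulr_ge0 ?exprn_ge0//; lra.
pose S0 := \sum_(k < N) (-1) ^+ k * ev (c * 16 ^+ m) k.
have x0 := @expr_ge0V R 4 m ltac:(lra).
have SS : `|S - S0| <= 16^-1 ^+ m.
  rewrite /S /S0 -sumrB; apply: le_trans (ler_norm_sum _ _ _) _.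
  apply: (@le_trans _ _ (\sum_(k < N) wt k * 16^-1 ^+ m)).
    apply: ler_sum => k _; rewrite -mulrBr normrM normrX normrN1 expr1n mul1r.
    apply: le_trans (ev_perturb _ _ d0) _.
    have e1 : ev (c * 16 ^+ m) k <= wt k by rewrite -ev0 ev_anti.
    have r0 := @rate_gt0 R k; have r1 := @rate_le R k.
    apply: ler_pM => //; first exact: ev_ge0.
      by rewrite mulr_ge0// ltW.
    by apply: le_trans d1; rewrite ler_piMr//; lra.
  rewrite -mulr_suml ler_piMl ?expr_ge0V//.
  by have := @sum_wt_le R N; lra.
have K : 4 ^+ m * `|S| <= 7 * 4^-1 ^+ m + 2 * 4^-1 ^+ dst m N.+1.
  have p0 : 0 <= 4 ^+ m :> R by rewrite exprn_ge0.
  have : `|4 ^+ m * S0| <= 6 * 4^-1 ^+ m + 2 * 4^-1 ^+ dst m N.+1.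
    rewrite /S0 H_block_ev normrM normrX normrN1 expr1n mul1r.
    exact: H_block_le.
  have E : 4 ^+ m * 16^-1 ^+ m = 4^-1 ^+ m :> R by rewrite -exprMn; congr (_ ^+ _); lra.
  rewrite normrM (ger0_norm p0).
  have := ler_wpM2l p0 SS; rewrite E.
  have : `|S| <= `|S - S0| + `|S0| by rewrite -{1}(subrK S0 S) ler_normD.
  by move=> /(ler_wpM2l p0); lra.
have d00 := @expr_ge0V R 4 (dst m N.+1) ltac:(lra).
have sq n : 16^-1 ^+ n = (4^-1 ^+ n) ^+ 2 :> R.
  by rewrite exprAC; congr (_ ^+ _); lra.
have -> : 16 ^+ m * S ^+ 2 = (4 ^+ m * `|S|) ^+ 2.
  rewrite exprMn real_normK ?num_real// exprAC; congr (_ ^+ _ * _); lra.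
have q0 : 0 <= 4 ^+ m * `|S| by rewrite mulr_ge0// exprn_ge0.
rewrite !sq; move: K x0 d00 q0.
move: (4 ^+ m * `|S|) (4^-1 ^+ m) (4^-1 ^+ dst m N.+1) => q x y K x0 d00 q0.
have : q ^+ 2 <= (7 * x + 2 * y) ^+ 2 by rewrite ler_sqr// nnegrE; lra.
by have := sqr_ge0 (7 * x - 2 * y); nra.
Qed.

(** The sum is at most 98 * 16/15 + 8 * 17/15 = 113.6, whatever the truncation N and the number M of
    blocks. *)
Lemma alternating_sum_le N M :
  \sum_(m < M) (98 * 16^-1 ^+ m + 8 * 16^-1 ^+ dst m N.+1) <= 115 :> R.
Proof.
rewrite big_split /= -!mulr_sumr.
have := @sum_dst_le R 16^-1 M N.+1 (17 / 15) ltac:(lra) ltac:(lra).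
have : \sum_(i < M) 16^-1 ^+ i <= 16 / 15 :> R.
  by rewrite (_ : 16 / 15 = (1 - 16^-1)^-1 :> R); [apply: sum_expr_le; lra|field].
lra.
Qed.

Lemma alternating_zero N : (\sum_(k < N) (-1) ^+ k * ev 0 k) ^+ 2 <= 1 :> R.
Proof.
have : `|\sum_(k < N) (-1) ^+ k * ev 0 k| <= 1 :> R.
  apply: le_trans (ler_norm_sum _ _ _) _.
  under eq_bigr do rewrite normrM normrX normrN1 expr1n mul1r ev0 ger0_norm ?(ltW (wt_gt0 _ _))//.
  by have := @sum_wt_le R N; lra.
by move=> H; rewrite -real_normK ?num_real// exprn_ile1.
Qed.

End Alternating.

(** * Sampled energies of square-summable sequences *)

Section Energy.
Variable R : realType.
Implicit Types (u : nat -> R) (t c B S : R) (T : set R).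

Definition sample t u : R := limn (series (fun k => u k * ev t k)).

Definition energy T u : \bar R := \esum_(t in T) ((sample t u) ^+ 2)%:E.

(** Only the smaller list has to be free of repetitions, so an enumeration of the times may list a
    point twice. *)
Lemma sum_sub_le (I : eqType) (s s' : seq I) (g : I -> R) :
  uniq s -> {subset s <= s'} -> (forall x, 0 <= g x) ->
  \sum_(x <- s) g x <= \sum_(x <- s') g x.
Proof.
move=> us ss g0; elim: s s' us ss => [|x s IH] s' /=.
  by rewrite big_nil => _ _; apply: sumr_ge0.
move=> /andP[xs us] ss.
rewrite big_cons [leRHS](big_rem x) ?ss ?mem_head//= lerD2l; apply: IH => // y ys.
apply: rem_mem; last by rewrite ss// inE ys orbT.
by apply: contraNneq xs => <-.
Qed.

Lemma ev_le_wt t k : 0 <= t -> ev t k <= wt k.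
Proof. by move=> t0; rewrite -ev0; apply: ev_anti. Qed.

(** Absolute convergence by comparison: |u_k| ev_k <= u_k^2 + ev_k^2, and ev_k^2 <= wt_k because
    ev_k <= wt_k <= 1/16. *)
Lemma sample_cvg t u B : 0 <= t -> (forall N, \sum_(k < N) u k ^+ 2 <= B) ->
  series (fun k => u k * ev t k) @ \oo --> sample t u.
Proof.
move=> t0 uB; apply: normed_cvg; apply: nondecreasing_is_cvgn.
  by apply: nondecreasing_series => k _ _; exact: normr_ge0.
exists (B + 1) => _ [N _ <-];
  rewrite -[leLHS]/(\sum_(0 <= k < N) `|u k * ev t k|) big_mkord.
apply: (@le_trans _ _ (\sum_(k < N) (u k ^+ 2 + wt k))).
  apply: ler_sum => k _; rewrite normrM (ger0_norm (ev_ge0 _ _)).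
  have e0 := ev_ge0 t k; have e1 := @ev_le_wt t k t0; have w1 := @wt_le R k.
  have := real_normK (num_real (u k)); set x := `|u k|.
  have x0 : 0 <= x by apply: normr_ge0.
  have w0 := @wt_gt0 R k.
  move=> <-; have := sqr_ge0 (x - ev t k); nra.
by rewrite big_split /=; apply: lerD (uB N) _; have := @sum_wt_le R N; lra.
Qed.

Lemma sample_fin_cvg t u N : (forall k, (N <= k)%N -> u k = 0) ->
  series (fun k => u k * ev t k) @ \oo --> \sum_(k < N) u k * ev t k.
Proof.
move=> uN; apply: cvg_near_cst; exists N => // n /= Nn.
rewrite /series /= -(big_mkord xpredT (fun k => u k * ev t k)).
rewrite (big_cat_nat (leq0n N) Nn) /= [X in _ + X]big1_seq ?addr0// => k.
by rewrite mem_index_iota => /andP[_ /andP[Nk _]]; rewrite uN// mul0r.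
Qed.

Lemma sample_fin t u N : (forall k, (N <= k)%N -> u k = 0) ->
  sample t u = \sum_(k < N) u k * ev t k.
Proof. by move=> uN; apply: cvg_lim => //; exact: sample_fin_cvg. Qed.

Lemma energy_le T u (C : R) : (forall t, T t -> 0 <= t) ->
  (forall s, uniq s -> (forall t, t \in s -> T t) ->
     \sum_(t <- s) (sample t u) ^+ 2 <= C) ->
  (energy T u <= C%:E)%E.
Proof.
move=> T0 H; apply: ge_ereal_sup => _ [X [Xfin XT] <-].
rewrite fsbig_finite//= sumEFin lee_fin; apply: H; first exact: finmap.fset_uniq.
by move=> t; rewrite in_fset_set// inE => /XT.
Qed.

(** Over finitely many times the sum commutes with the limit in N, so bounds for truncated sequences
    pass to the samples. *)
Lemma sum_sample_le (s : seq R) u (C B : R) : (forall t, t \in s -> 0 <= t) ->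
  0 <= C -> (forall N, \sum_(k < N) u k ^+ 2 <= B) ->
  (forall N, \sum_(t <- s) (\sum_(k < N) u k * ev t k) ^+ 2 <=
             C * \sum_(k < N) u k ^+ 2) ->
  \sum_(t <- s) (sample t u) ^+ 2 <= C * B.
Proof.
move=> s0 C0 uB H.
have c : \sum_(t <- s) (\sum_(k < N) u k * ev t k) ^+ 2 @[N --> \oo] -->
    \sum_(t <- s) (sample t u) ^+ 2.
  have E : (fun N => \sum_(t <- s) (\sum_(k < N) u k * ev t k) ^+ 2) =
           (fun N => \sum_(t <- s | t \in s) (\sum_(k < N) u k * ev t k) ^+ 2).
    by apply: funext => N; rewrite [LHS]big_seq.
  rewrite E [X in _ --> X]big_seq; apply: cvg_big => [|t ts].
    exact: add_continuous.
  have cc : \sum_(k < N) u k * ev t k @[N --> \oo] --> sample t u.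
    under eq_cvg do rewrite -(big_mkord xpredT (fun k => u k * ev t k)).
    exact: sample_cvg (s0 _ ts) uB.
  by rewrite expr2; under eq_cvg do rewrite expr2; exact: (cvgM cc cc).
rewrite -(cvg_lim _ c)//; apply: limr_le; first by apply/cvg_ex; eexists; exact: c.
by near=> N; apply: le_trans (H N) _; rewrite ler_wpM2l.
Unshelve. all: by end_near. Qed.

Lemma nat_times_sub (s : seq R) : (forall t, t \in s -> nat_times t) ->
  exists M, {subset s <= [seq n%:R | n <- iota 0 M]}.
Proof.
elim: s => [|t s IH] H; first by exists 0%N.
have [M sM] := IH (fun x xs => H x (mem_behead (s := t :: s) xs)).
have [n _ nt] := H t (mem_head _ _).
exists (maxn M n.+1) => x; rewrite inE => /orP[/eqP->|/sM/mapP[p pM ->]].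
  by rewrite -nt map_f// mem_iota leq0n add0n leq_max leqnn orbT.
by rewrite map_f//; move: pM; rewrite !mem_iota; lia.
Qed.

Lemma big_map_iota (f : R -> R) M :
  \sum_(t <- [seq n%:R | n <- iota 0 M]) f t = \sum_(n < M) f n%:R.
Proof. by rewrite big_map -(big_mkord xpredT (fun n => f n%:R)) /index_iota subn0. Qed.

Lemma nat_energy_upper u B : (forall N, \sum_(k < N) u k ^+ 2 <= B) ->
  (energy nat_times u <= (4 * B)%:E)%E.
Proof.
move=> uB; apply: energy_le => [_ [n _ <-]//|s us sT].
have [M sM] := nat_times_sub sT.
apply: sum_sample_le => // [t /sT[n _ <-]//|N].
apply: le_trans (nat_energy_le u N M).
rewrite -(big_map_iota (fun t => (\sum_(k < N) u k * ev t k) ^+ 2)).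
by apply: (sum_sub_le (g := fun t => (\sum_(k < N) u k * ev t k) ^+ 2)) => // x;
  exact: sqr_ge0.
Qed.

Definition block_points c M : seq R :=
  0 :: flatten [seq [seq c * 16 ^+ m + l%:R * 16 ^- (2 * m) | l <- iota 1 (16 ^ m)]
               | m <- iota 0 M].

Lemma time_set_sub c (s : seq R) : (forall t, t \in s -> time_set 16%:R c t) ->
  exists M, {subset s <= block_points c M}.
Proof.
elim: s => [|t s IH] H; first by exists 0%N.
have [M sM] := IH (fun x xs => H x (mem_behead (s := t :: s) xs)).
have mono M' : (M <= M')%N -> {subset block_points c M <= block_points c M'}.
  move=> MM x; rewrite !inE => /orP[->//|/flatten_mapP[m mM xm]].
  apply/orP; right; apply/flatten_mapP; exists m => //.
  by move: mM; rewrite !mem_iota; lia.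
case: (H t (mem_head _ _)) => [t0|[m _ [l [l1 lq] lt]]].
  exists M => x; rewrite inE => /orP[/eqP->|/sM//].
  by rewrite t0 inE eqxx.
exists (maxn M m.+1) => x; rewrite inE => /orP[/eqP->|/sM].
  rewrite inE; apply/orP; right; apply/flatten_mapP; exists m.
    by rewrite mem_iota; lia.
  rewrite -lt; apply/mapP; exists l => //.
  by rewrite mem_iota l1 add1n ltnS; move: lq; rewrite -natrX ler_nat.
by apply: mono; rewrite leq_maxl.
Qed.

(** This dichotomy is the range of exponents in which the operator powers are computed. *)
Lemma time_set_ge0 c t : 1 < c -> time_set 16%:R c t -> t = 0 \/ 1 <= t.
Proof.
move=> c1 [->|[m _ [l _ <-]]]; [by left|right].
have : 1 <= 16%:R ^+ m :> R by rewrite exprn_ege1// ler1n.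
have : 0 <= l%:R * 16%:R ^- (2 * m) :> R by rewrite mulr_ge0// invr_ge0 exprn_ge0.
nra.
Qed.

Lemma block_points_le c M (g : R -> R) (G : nat -> R) :
  (forall m l, (1 <= l <= 16 ^ m)%N ->
     g (c * 16 ^+ m + l%:R * 16 ^- (2 * m)) <= G m) ->
  \sum_(t <- block_points c M) g t <= g 0 + \sum_(m < M) 16 ^+ m * G m.
Proof.
move=> gG; rewrite /block_points big_cons lerD2l big_flatten /= big_map.
rewrite -(big_mkord xpredT (fun m => 16 ^+ m * G m)) /index_iota subn0.
apply: ler_sum => m _; rewrite big_map.
have -> : 16 ^+ m * G m = \sum_(l <- iota 1 (16 ^ m)) G m.
  by rewrite big_const_seq count_predT size_iota iter_addr_0 -natrX mulr_natl.
rewrite !big_seq; apply: ler_sum => l; rewrite mem_iota add1n ltnS.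
exact: gG.
Qed.

Lemma time_energy_upper c u B : 1 < c ->
  (forall N, \sum_(k < N) u k ^+ 2 <= B) ->
  (energy (time_set 16%:R c) u <= (5 * B)%:E)%E.
Proof.
move=> c1 uB; apply: energy_le => [t /(time_set_ge0 c1)[->//|]|s us sT].
  exact: le_trans.
have [M sM] := time_set_sub sT.
apply: sum_sample_le => // [t /sT/(time_set_ge0 c1)[->//|]|N].
  exact: le_trans.
apply: (@le_trans _ _ (\sum_(t <- block_points c M) (\sum_(k < N) u k * ev t k) ^+ 2)).
  by apply: (sum_sub_le (g := fun t => (\sum_(k < N) u k * ev t k) ^+ 2)) => // x;
    exact: sqr_ge0.
(* Every point of block m is at least 16^m and [ev] decreases in t, so one bound at 16^m serves the
   whole block. The constant 5 is 1 for the time 0 plus 4 for the blocks. *)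
apply: le_trans (@block_points_le c M _
  (fun m => (\sum_(k < N) `|u k| * ev (16 ^+ m) k) ^+ 2) _) _.
  move=> m l _; rewrite -real_normK ?num_real// ler_sqr ?nnegrE//; last first.
    by apply: sumr_ge0 => k _; rewrite mulr_ge0// ev_ge0.
  apply: le_trans (ler_norm_sum _ _ _) _; apply: ler_sum => k _.
  rewrite normrM (ger0_norm (ev_ge0 _ _)) ler_wpM2l//; apply: ev_anti.
  have h1 : 0 <= l%:R * 16%:R ^- (2 * m) :> R.
    by rewrite mulr_ge0// invr_ge0 exprn_ge0.
  have h2 : 0 <= 16 ^+ m :> R by rewrite exprn_ge0.
  nra.
have := zero_energy_le u N; have := block_energy_le u N M; lra.
Qed.

Definition alt (N k : nat) : R := if (k < N)%N then (-1) ^+ k else 0.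

Lemma time_energy_alternating c N : 1 < c -> H_sum 16%:R c = 0 ->
  (energy (time_set 16%:R c) (alt N) <= 116%:E)%E.
Proof.
move=> c1 H0; apply: energy_le => [t /(time_set_ge0 c1)[->//|]|s us sT].
  exact: le_trans.
have E t : sample t (alt N) =
           \sum_(k < N) (-1) ^+ k * ev t k.
  rewrite (@sample_fin _ _ N) => [|k]; last by rewrite /alt ltnNge => ->.
  by apply: eq_bigr => k _; rewrite /alt ltn_ord.
under eq_bigr do rewrite E.
have [M sM] := time_set_sub sT.
apply: (@le_trans _ _ (\sum_(t <- block_points c M) (\sum_(k < N) (-1) ^+ k * ev t k) ^+ 2)).
  by apply: (sum_sub_le (g := fun t => (\sum_(k < N) (-1) ^+ k * ev t k) ^+ 2))
    => // x; exact: sqr_ge0.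
(* [alternating_block] bounds 16^m times the square; the resulting factor 16^-m cancels against the
   16^m points of the block. *)
apply: le_trans (@block_points_le c M _
  (fun m => 16 ^- m * (98 * 16^-1 ^+ m + 8 * 16^-1 ^+ dst m N.+1)) _) _.
  move=> m l /andP[l1 l2].
  have p0 : 0 < 16 ^+ m :> R by rewrite exprn_gt0.
  rewrite ler_pdivlMl//; apply: alternating_block (ltW c1) H0 _.
  have q0 : 0 < 16 ^+ (2 * m) :> R by rewrite exprn_gt0.
  rewrite lerDl lerD2l divr_ge0 ?(ltW q0)//= ler_pdivrMr//.
  rewrite mul2n -addnn exprD mulrA exprVn mulVf ?mul1r ?lt0r_neq0//.
  by rewrite -natrX ler_nat.
have -> : \sum_(m < M) 16 ^+ m * (16 ^- m * (98 * 16^-1 ^+ m + 8 * 16^-1 ^+ dst m N.+1))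
    = \sum_(m < M) (98 * 16^-1 ^+ m + 8 * 16^-1 ^+ dst m N.+1) :> R.
  by apply: eq_bigr => m _; rewrite mulrA mulfV ?mul1r// expf_neq0 ?pnatr_eq0.
have := @alternating_zero R N; have := @alternating_sum_le R N M; lra.
Qed.

(** A truncation of u is u minus a tail, and by the upper bound the tail has energy at most 4 (S - P
    N). Combined with (a + b)^2 <= 2a^2 + 2b^2, the truncated lower bound becomes one for u as N
    grows; the factor 2 turns 1/20 into 1/40. *)
Lemma nat_energy_lower u S (E : R) :
  (forall N, \sum_(k < N) u k ^+ 2 <= S) ->
  \sum_(k < N) u k ^+ 2 @[N --> \oo] --> S ->
  (forall M, \sum_(n < M) (sample n%:R u) ^+ 2 <= E) ->
  40^-1 * S <= E.
Proof.
move=> uS cS uE.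
pose P N := \sum_(k < N) u k ^+ 2.
have tail N M : \sum_(n < M) (sample n%:R u - \sum_(k < N) u k * ev n%:R k) ^+ 2
    <= 4 * (S - P N).
  pose v k := if (k < N)%N then 0 else u k.
  have vP N' : \sum_(k < N') v k ^+ 2 <= S - P N.
    rewrite lerBrDr; apply: le_trans (uS (maxn N N')).
    rewrite /P (@big_ord_widen _ _ _ N (maxn N N') (fun k => u k ^+ 2)) ?leq_maxl//.
    rewrite (@big_ord_widen _ _ _ N' (maxn N N') (fun k => v k ^+ 2)) ?leq_maxr//.
    rewrite big_mkcond [X in _ + X]big_mkcond -big_split /=.
    apply: ler_sum => k _; rewrite /v; case: ifP => _; case: ifP => _;
      by rewrite ?expr0n ?addr0 ?add0r ?sqr_ge0.
  have SP0 : 0 <= S - P N by have := vP 0%N; rewrite big_ord0.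
  have vE n : sample n%:R v = sample n%:R u - \sum_(k < N) u k * ev n%:R k.
    pose w k := if (k < N)%N then u k else 0.
    have wN : forall k, (N <= k)%N -> w k = 0.
      by move=> k; rewrite /w ltnNge => ->.
    have -> : \sum_(k < N) u k * ev n%:R k = \sum_(k < N) w k * ev n%:R k.
      by apply: eq_bigr => k _; rewrite /w ltn_ord.
    apply: cvg_lim => //.
    have -> : series (fun k => v k * ev n%:R k) =
        series (fun k => u k * ev n%:R k) \- series (fun k => w k * ev n%:R k).
      apply: funext => p; rewrite /series /= -sumrB; apply: eq_bigr => k _.
      by rewrite /v /w; case: ifP => _; ring.
    by apply: cvgB; [exact: sample_cvg uS|exact: sample_fin_cvg].
  under eq_bigr do rewrite -vE.
  rewrite -(big_map_iota (fun t => sample t v ^+ 2)).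
  apply: sum_sample_le => // [t /mapP[n _ ->]//|N'].
  rewrite (big_map_iota (fun t => (\sum_(k < N') v k * ev t k) ^+ 2)).
  exact: nat_energy_le.
have E0 : 0 <= E by have := uE 0%N; rewrite big_ord0.
have fin N : 20^-1 * P N <= 2 * E + 8 * (S - P N).
  apply: nat_energy_ge => M.
  apply: (@le_trans _ _ (\sum_(n < M) (2 * (sample n%:R u) ^+ 2 +
      2 * (sample n%:R u - \sum_(k < N) u k * ev n%:R k) ^+ 2))).
    apply: ler_sum => n _; set x := sample _ _; set y := \sum_(k < N) _.
    by have := sqr_ge0 (2 * x - y); nra.
  rewrite big_split /= -!mulr_sumr; have := uE M; have := tail N M; lra.
have c : (20^-1 + 8) * P N @[N --> \oo] --> (20^-1 + 8) * S by exact: cvgMl_tmp.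
have : (20^-1 + 8) * S <= 2 * E + 8 * S.
  rewrite -(cvg_lim _ c)//; apply: limr_le; first by apply/cvg_ex; eexists; exact: c.
  by near=> N; have := fin N; lra.
lra.
Unshelve. all: by end_near. Qed.

Lemma nat_energy_ge_lower u S :
  (forall N, \sum_(k < N) u k ^+ 2 <= S) ->
  \sum_(k < N) u k ^+ 2 @[N --> \oo] --> S ->
  ((40^-1 * S)%:E <= energy nat_times u)%E.
Proof.
move=> uS cS.
have eM M : ((\sum_(n < M) (sample n%:R u) ^+ 2)%:E <= energy nat_times u)%E.
  pose X := (fun n : nat => n%:R : R) @` `I_M.
  apply: esum_ge; exists X.
    split; first by apply: finite_image; exact: finite_II.
    by move=> _ [n _ <-]; exists n.
  rewrite /X fsbig_image; first by rewrite -fsbig_ord sumEFin.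
  by move=> n p _ _ /eqP; rewrite eqr_nat => /eqP.
case: (energy nat_times u) eM => [E| |] eM.
- by rewrite lee_fin; apply: nat_energy_lower uS cS _ => M; rewrite -lee_fin.
- by rewrite leey.
- by have := eM 0%N; rewrite leeNy_eq.
Qed.

End Energy.

(** * The Hilbert space of square-summable sequences of rows *)

Section RowSquare.
Variables (R : realType) (m : nat).
Implicit Types (v w : 'rV[R[i]]_m) (z : R[i]).

(** The squared modulus as a real number, so that estimates take place in the ordered field R and
    not in [R[i]]. *)
Definition csq z : R := complex.Re z ^+ 2 + complex.Im z ^+ 2.

Definition rsq v : R := \sum_(i < m) csq (v 0 i).

Lemma csq_ge0 z : 0 <= csq z. Proof. by rewrite addr_ge0 ?sqr_ge0. Qed.

Lemma csqE z : `|z| ^+ 2 = (csq z)%:C%C.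
Proof. by rewrite -add_Re2_Im2. Qed.

Lemma csqM z z' : csq (z * z') = csq z * csq z'.
Proof. by case: z z' => [a b] [c d]; rewrite /csq /=; ring. Qed.

Lemma csqN z : csq (- z) = csq z.
Proof. by case: z => a b; rewrite /csq /= !sqrrN. Qed.

Lemma csq_eq0 z : csq z = 0 -> z = 0.
Proof.
case: z => a b; rewrite /csq /= => /eqP.
by rewrite paddr_eq0 ?sqr_ge0// !sqrf_eq0 => /andP[/eqP-> /eqP->].
Qed.

(** Young's inequality with a free parameter. For vectors of norms a and b the choice s = b/a gives
    (a + b)^2, hence the triangle inequality. *)
Lemma csqD_le (s : R) z z' : 0 < s ->
  csq (z + z') <= (1 + s) * csq z + (1 + s^-1) * csq z'.
Proof.
case: z z' => [a b] [c d] s0; rewrite /csq /=.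
have key (x y : R) : (x + y) ^+ 2 <= (1 + s) * x ^+ 2 + (1 + s^-1) * y ^+ 2.
  have := mulr_ge0 (ltW s0) (sqr_ge0 (x - s^-1 * y)).
  have -> : s * (x - s^-1 * y) ^+ 2 = s * x ^+ 2 - 2 * x * y + s^-1 * y ^+ 2.
    by field; rewrite lt0r_neq0.
  lra.
by have := key a c; have := key b d; lra.
Qed.

Lemma rsq_ge0 v : 0 <= rsq v.
Proof. by apply: sumr_ge0 => i _; rewrite csq_ge0. Qed.

Lemma csq_le_rsq v i : csq (v 0 i) <= rsq v.
Proof.
by rewrite /rsq (bigD1 i)//= lerDl; apply: sumr_ge0 => j _; rewrite csq_ge0.
Qed.

Lemma rsqZ z v : rsq (z *: v) = csq z * rsq v.
Proof. by rewrite mulr_sumr; apply: eq_bigr => i _; rewrite mxE csqM. Qed.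

Lemma rsqN v : rsq (- v) = rsq v.
Proof. by apply: eq_bigr => i _; rewrite mxE csqN. Qed.

Lemma rsq0 : rsq 0 = 0.
Proof. by apply: big1 => i _; rewrite mxE /csq /= expr0n addr0. Qed.

Lemma rsq_eq0 v : rsq v = 0 -> v = 0.
Proof.
move=> v0; apply/rowP => i; rewrite mxE; apply: csq_eq0; apply/eqP.
by rewrite eq_le csq_ge0 andbT -v0 csq_le_rsq.
Qed.

Lemma rsqD_le (s : R) v w : 0 < s ->
  rsq (v + w) <= (1 + s) * rsq v + (1 + s^-1) * rsq w.
Proof.
move=> s0; rewrite !mulr_sumr -big_split /=.
by apply: ler_sum => i _; rewrite mxE csqD_le.
Qed.

Definition rdot v w : R[i] := \sum_(i < m) v 0 i * Num.conj (w 0 i).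

Lemma rdotDl v w w' : rdot (v + w) w' = rdot v w' + rdot w w'.
Proof. by rewrite -big_split; apply: eq_bigr => i _ /=; rewrite mxE mulrDl. Qed.

Lemma rdotZl z v w : rdot (z *: v) w = z * rdot v w.
Proof. by rewrite mulr_sumr; apply: eq_bigr => i _; rewrite mxE mulrA. Qed.

Lemma rdotC v w : rdot v w = Num.conj (rdot w v).
Proof.
rewrite rmorph_sum; apply: eq_bigr => i _.
by rewrite rmorphM /= conjCK mulrC.
Qed.

Lemma Re_sum (I : Type) (s : seq I) (F : I -> R[i]) :
  complex.Re (\sum_(i <- s) F i) = \sum_(i <- s) complex.Re (F i).
Proof.
by elim/big_rec2: _ => [//|i x y _ <-]; case: (F i) => a b; case: y.
Qed.

Lemma Im_sum (I : Type) (s : seq I) (F : I -> R[i]) :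
  complex.Im (\sum_(i <- s) F i) = \sum_(i <- s) complex.Im (F i).
Proof.
by elim/big_rec2: _ => [//|i x y _ <-]; case: (F i) => a b; case: y.
Qed.

Lemma rdot_self v : rdot v v = (rsq v)%:C%C.
Proof.
rewrite /rdot /rsq (raddf_sum (real_complex R)).
by apply: eq_bigr => i _; exact: (etrans (esym (sqr_normc _)) (csqE _)).
Qed.

Lemma rdot_bounds v w :
  `|complex.Re (rdot v w)| <= rsq v + rsq w /\
  `|complex.Im (rdot v w)| <= rsq v + rsq w.
Proof.
rewrite /rdot Re_sum Im_sum /rsq -big_split /=.
split; apply: le_trans (ler_norm_sum _ _ _) _; apply: ler_sum => i _;
  case: (v 0 i) (w 0 i) => [a b] [c d]; rewrite /csq /=;
  rewrite ler_norml; apply/andP; split;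
  have := sqr_ge0 (a + c); have := sqr_ge0 (b + d);
  have := sqr_ge0 (a - c); have := sqr_ge0 (b - d);
  have := sqr_ge0 (a + d); have := sqr_ge0 (b + c);
  have := sqr_ge0 (a - d); have := sqr_ge0 (b - c); nra.
Qed.

End RowSquare.

Section SquareSummable.
Variables (R : realType) (m : nat).
Local Notation row := 'rV[R[i]]_m.
Implicit Types (x y : nat -> row).

Definition l2_summable x : Prop :=
  exists B : R, forall N, \sum_(k < N) rsq (x k) <= B.

Definition nsq x : R := limn (series (fun k => rsq (x k))).

Lemma series_rsq_homo x :
  {homo series (fun k => rsq (x k)) : n p / (n <= p)%N >-> n <= p}.
Proof. by apply: nondecreasing_series => k _ _; apply: rsq_ge0. Qed.

Lemma l2_cvg x : l2_summable x -> cvgn (series (fun k => rsq (x k))).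
Proof.
move=> [B xB]; apply: nondecreasing_is_cvgn; first exact: series_rsq_homo.
by exists B => _ [N _ <-]; rewrite /series /= big_mkord.
Qed.

Lemma nsq_ub x N : l2_summable x -> \sum_(k < N) rsq (x k) <= nsq x.
Proof.
move=> /l2_cvg cx; rewrite -(big_mkord xpredT (fun k => rsq (x k))).
exact: (nondecreasing_cvgn_le (@series_rsq_homo x) cx N).
Qed.

Lemma nsq_lub x B : (forall N, \sum_(k < N) rsq (x k) <= B) -> nsq x <= B.
Proof.
move=> xB; apply: limr_le; first by apply: l2_cvg; exists B.
by near=> N; rewrite /series /= big_mkord.
Unshelve. all: by end_near. Qed.

Lemma nsq_ge0 x : l2_summable x -> 0 <= nsq x.
Proof. by move/(@nsq_ub x 0); rewrite big_ord0. Qed.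

Lemma rsq_le_nsq x k : l2_summable x -> rsq (x k) <= nsq x.
Proof.
move=> /(@nsq_ub x k.+1); rewrite big_ord_recr /=; apply: le_trans.
by rewrite lerDr; apply: sumr_ge0 => i _; apply: rsq_ge0.
Qed.

Lemma nsqD_le (s : R) x y : 0 < s -> l2_summable x -> l2_summable y ->
  forall N, \sum_(k < N) rsq (x k + y k) <=
    (1 + s) * nsq x + (1 + s^-1) * nsq y.
Proof.
move=> s0 sx sy N.
have s10 : 0 < s^-1 by rewrite invr_gt0.
apply: (@le_trans _ _ (\sum_(k < N)
    ((1 + s) * rsq (x k) + (1 + s^-1) * rsq (y k)))).
  by apply: ler_sum => k _; apply: rsqD_le.
rewrite big_split /= -!mulr_sumr.
by apply: lerD; apply: ler_wpM2l; rewrite ?nsq_ub//; lra.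
Qed.

Definition l2_pred : {pred nat -> row} := fun x => `[< l2_summable x >].

Lemma l2_submod_closed : submod_closed l2_pred.
Proof.
split; first by apply/asboolP; exists 0 => N; rewrite big1// => k _; apply: rsq0.
move=> a x y /asboolP sx /asboolP sy; apply/asboolP.
have sax : l2_summable (a *: x).
  exists (csq a * nsq x) => N; under eq_bigr do rewrite rsqZ.
  by rewrite -mulr_sumr ler_wpM2l ?csq_ge0// nsq_ub.
by exists ((1 + 1) * nsq (a *: x) + (1 + 1^-1) * nsq y); apply: nsqD_le.
Qed.

HB.instance Definition _ := GRing.isSubmodClosed.Build _ _ l2_pred
  l2_submod_closed.

Record l2 := MkL2 { l2val :> nat -> row ; l2valP : l2val \in l2_pred }.

HB.instance Definition _ := [isSub for l2val].
HB.instance Definition _ := [Choice of l2 by <:].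
HB.instance Definition _ := [SubChoice_isSubLmodule of l2 by <:].

Implicit Types (f g : l2).

Lemma l2P f : l2_summable f. Proof. by have /asboolP := l2valP f. Qed.

Definition toL2 x (sx : l2_summable x) : l2 := MkL2 (asboolT sx : x \in l2_pred).

Lemma l2_ext f g : (forall k, f k = g k) -> f = g.
Proof. by move=> fg; apply: val_inj; apply: funext. Qed.

Lemma l2D f g k : (f + g) k = f k + g k. Proof. by []. Qed.
Lemma l2B f g k : (f - g) k = f k - g k. Proof. by []. Qed.
Lemma l2Z a f k : (a *: f) k = a *: f k. Proof. by []. Qed.

Definition l2norm f : R[i] := (Num.sqrt (nsq f))%:C%C.

Lemma nsqZ (a : R[i]) f : nsq (a *: f) = csq a * nsq f.
Proof.
rewrite /nsq; under eq_fun do rewrite rsqZ.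
have -> : series (fun k => csq a * rsq (f k)) =
          (fun N => csq a * series (fun k => rsq (f k)) N).
  by apply: funext => N; rewrite /series /= mulr_sumr.
by apply: cvg_lim => //; apply: cvgMr; apply: l2_cvg; exact: l2P.
Qed.

Lemma nsq_eq0 f : nsq f = 0 -> f = 0.
Proof.
move=> f0; apply: l2_ext => k; apply: rsq_eq0; apply/eqP.
by rewrite eq_le rsq_ge0 andbT -f0 rsq_le_nsq//; exact: l2P.
Qed.

Lemma l2norm_le f (B : R) : 0 <= B ->
  (forall N, \sum_(k < N) rsq (f k) <= B ^+ 2) -> l2norm f <= B%:C%C.
Proof.
move=> B0 fB; rewrite lecR -(ger0_norm B0) -sqrtr_sqr ler_wsqrtr//.
exact: nsq_lub.
Qed.

Lemma l2_nsq_ge0 f : 0 <= nsq f. Proof. exact/nsq_ge0/l2P. Qed.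

Lemma nsq0 : nsq (0 : l2) = 0.
Proof.
apply/le_anti/andP; split; last exact: l2_nsq_ge0.
by apply: nsq_lub => N; rewrite big1// => k _; rewrite rsq0.
Qed.

Lemma ler_l2normD f g : l2norm (f + g) <= l2norm f + l2norm g.
Proof.
have [->|f0] := eqVneq f 0; first by rewrite add0r /l2norm nsq0 sqrtr0 add0r.
have [->|g0] := eqVneq g 0; first by rewrite addr0 /l2norm nsq0 sqrtr0 addr0.
have pos (h : l2) : h != 0 -> 0 < nsq h.
  move=> h0; rewrite lt_def l2_nsq_ge0 andbT.
  by apply: contra h0 => /eqP/nsq_eq0 ->.
have E : l2norm f + l2norm g = (Num.sqrt (nsq f) + Num.sqrt (nsq g))%:C%C.
  by rewrite /l2norm rmorphD.
rewrite E; apply: l2norm_le; first by rewrite addr_ge0// sqrtr_ge0.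
move=> N; set a := Num.sqrt _; set b := Num.sqrt _.
have a0 : 0 < a by rewrite sqrtr_gt0 pos.
have b0 : 0 < b by rewrite sqrtr_gt0 pos.
have := @nsqD_le (b / a) f g (divr_gt0 b0 a0) (l2P f) (l2P g) N.
have -> : nsq f = a ^+ 2 by rewrite sqr_sqrtr// ltW// pos.
have -> : nsq g = b ^+ 2 by rewrite sqr_sqrtr// ltW// pos.
move=> H; apply: le_trans H _; rewrite le_eqVlt; apply/orP; left; apply/eqP.
by field; rewrite !lt0r_neq0.
Qed.

Lemma l2normZ (a : R[i]) f : l2norm (a *: f) = `|a| * l2norm f.
Proof.
rewrite /l2norm nsqZ sqrtrM ?csq_ge0// rmorphM /=; congr (_ * _).
by rewrite [RHS]normc_def.
Qed.

Lemma l2norm_eq0 f : l2norm f = 0 -> f = 0.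
Proof.
move=> /complexI /eqP; rewrite sqrtr_eq0 => f0; apply: nsq_eq0; apply/eqP.
by rewrite eq_le f0 l2_nsq_ge0.
Qed.

HB.instance Definition _ := Lmodule_isNormed.Build R[i] l2
  ler_l2normD l2normZ l2norm_eq0.

Lemma l2_normE f : `|f| = (Num.sqrt (nsq f))%:C%C. Proof. by []. Qed.

Lemma l2_normsq f : `|f| ^+ 2 = (nsq f)%:C%C.
Proof. by rewrite l2_normE -rmorphXn /= sqr_sqrtr// l2_nsq_ge0. Qed.

Lemma l2_norm_lt f (e : R) : (`|f| < e%:C%C) = (Num.sqrt (nsq f) < e).
Proof. by rewrite l2_normE ltcR. Qed.

Lemma csq_le_nsq f k i : csq (f k 0 i) <= nsq f.
Proof.
by apply: le_trans (csq_le_rsq _ _) _; apply: rsq_le_nsq; exact: l2P.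
Qed.

Lemma coord_norm_le f k i :
  `|complex.Re (f k 0 i)| <= Num.sqrt (nsq f) /\
  `|complex.Im (f k 0 i)| <= Num.sqrt (nsq f).
Proof.
have := csq_le_nsq f k i; rewrite /csq => H.
have r0 := sqr_ge0 (complex.Re (f k 0 i)).
have i0 := sqr_ge0 (complex.Im (f k 0 i)).
by rewrite -!sqrtr_sqr; split; apply: ler_wsqrtr; lra.
Qed.

(** Real and imaginary parts of coordinates are 1-Lipschitz, so they converge along F. Bounds on
    partial sums of squares pass to this coordinatewise limit, which shows both that it is
    square-summable and that F converges to it in norm. *)
Lemma l2_complete (F : set_system l2) : ProperFilter F -> cauchy F -> cvg F.
Proof.
move=> FF Fc.
have Fx (e : R) : 0 < e ->
    exists x : l2, F [set y | Num.sqrt (nsq (x - y)) < e].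
  move=> e0; have /cauchyP/(_ e%:C%C) := Fc.
  move=> /(_ _)[]; first by rewrite ltcR.
  move=> x xe; exists x; move: xe; apply: filterS => y.
  by rewrite -ball_normE /= l2_norm_lt.
have coord_cvg (p : l2 -> R) :
    (forall f g, p (f - g) = p f - p g) ->
    (forall f, `|p f| <= Num.sqrt (nsq f)) -> cvg (p x @[x --> F]).
  move=> pB pn; apply: R_complete; apply/cauchyP => e e0.
  have [x xe] := Fx _ e0; exists (p x); rewrite /nbhs /=.
  move: xe; apply: filterS => y /= xy; rewrite -ball_normE /= -pB.
  exact: le_lt_trans xy.
pose lre k i : R := lim (complex.Re ((x : l2) k 0 i) @[x --> F]).
pose lim_im k i : R := lim (complex.Im ((x : l2) k 0 i) @[x --> F]).
have cre k i : complex.Re ((x : l2) k 0 i) @[x --> F] --> lre k i.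
  have pB (f g : l2) : complex.Re ((f - g) k 0 i) =
      complex.Re (f k 0 i) - complex.Re (g k 0 i).
    by rewrite l2B !mxE; case: (f k 0 i); case: (g k 0 i).
  by apply: (coord_cvg _ pB) => f; have [] := coord_norm_le f k i.
have cim k i : complex.Im ((x : l2) k 0 i) @[x --> F] --> lim_im k i.
  have pB (f g : l2) : complex.Im ((f - g) k 0 i) =
      complex.Im (f k 0 i) - complex.Im (g k 0 i).
    by rewrite l2B !mxE; case: (f k 0 i); case: (g k 0 i).
  by apply: (coord_cvg _ pB) => f; have [] := coord_norm_le f k i.
pose l k : row := \row_i (lre k i +i* lim_im k i)%C.
have key (e : R) (x : l2) : F [set y | Num.sqrt (nsq (x - y)) < e] ->
    forall N, \sum_(k < N) rsq (x k - l k) <= e ^+ 2.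
  move=> xe N.
  have e0 : 0 <= e.
    by have [y /= ye] := filter_ex xe; apply: ltW; apply: le_lt_trans ye;
      rewrite sqrtr_ge0.
  have c : \sum_(k < N) rsq (x k - (y : l2) k) @[y --> F] -->
           \sum_(k < N) rsq (x k - l k).
    apply: cvg_big => [|k _]; first exact: add_continuous.
    apply: cvg_big => [|i _]; first exact: add_continuous.
    have Ere (y : row) : complex.Re ((x k - y) 0 i) =
       complex.Re (x k 0 i) - complex.Re (y 0 i).
      by rewrite !mxE; case: (x k 0 i); case: (y 0 i).
    have Eim (y : row) : complex.Im ((x k - y) 0 i) =
       complex.Im (x k 0 i) - complex.Im (y 0 i).
      by rewrite !mxE; case: (x k 0 i); case: (y 0 i).
    have sqc (a b : R) (g : l2 -> R) : g y @[y --> F] --> b ->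
        (a - g y) ^+ 2 @[y --> F] --> (a - b) ^+ 2.
      move=> gb; have cc : a - g y @[y --> F] --> a - b.
        by apply: cvgB => //; exact: cvg_cst.
      by rewrite expr2; under eq_cvg do rewrite expr2; exact: (cvgM cc cc).
    rewrite /csq; under eq_cvg do rewrite Ere Eim.
    rewrite Ere Eim [l k 0 i]mxE /=; apply: cvgD.
      exact: (sqc (complex.Re (x k 0 i)) (lre k i)
        (fun y : l2 => complex.Re (y k 0 i)) (cre k i)).
    exact: (sqc (complex.Im (x k 0 i)) (lim_im k i)
      (fun y : l2 => complex.Im (y k 0 i)) (cim k i)).
  rewrite -(cvg_lim _ c)//; apply: limr_le; first by apply/cvg_ex; eexists; exact: c.
  move: xe; apply: filterS => y /= xy.
  apply: (@le_trans _ _ (nsq (x - y))).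
    by apply: (@nsq_ub (x - y)); exact: l2P.
  rewrite -[nsq _]sqr_sqrtr ?l2_nsq_ge0//.
  by rewrite ler_sqr ?nnegrE ?sqrtr_ge0// ltW.
have sl : l2_summable l.
  have [x /key xl] := Fx 1 ltr01.
  have sxl : l2_summable (fun k => x k - l k) by exists (1 ^+ 2).
  have sxl' : l2_summable (fun k => - (x k - l k)).
    by case: sxl => B sB; exists B => N; under eq_bigr do rewrite rsqN.
  have := @nsqD_le 1 x _ ltr01 (l2P x) sxl'.
  set B := (X in forall N, _ <= X) => sB; exists B => N.
  by apply: le_trans (sB N); under [X in _ <= X]eq_bigr do rewrite opprB addrC subrK.
apply/cvg_ex; exists (toL2 sl).
apply/cvg_ballP => e e0.
(* A positive element of [R[i]] is real, so radii may be taken in R. *)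
have [e' E] : exists e' : R, e = e'%:C%C.
  by exists (complex.Re e); case: e e0 => a b; rewrite ltcE /= => /andP[/eqP-> _].
move: e0; rewrite E ltcR => e0.
have e20 : 0 < e' / 2 by rewrite divr_gt0.
have [x xe] := Fx _ e20.
have xl : `|x - toL2 sl| <= (e' / 2)%:C%C.
  by apply: l2norm_le; [exact: ltW|exact: key].
near=> y; rewrite -ball_normE /=.
have xy : `|x - y| < (e' / 2)%:C%C by rewrite l2_norm_lt; near: y.
have -> : toL2 sl - y = (x - y) - (x - toL2 sl) by rewrite opprB [RHS]addrC addrA subrK.
apply: le_lt_trans (ler_normB _ _) _.
by rewrite [e']splitr rmorphD /=; apply: ltr_leD.
Unshelve. all: by end_near. Qed.

HB.instance Definition _ := Uniform_isComplete.Build l2 l2_complete.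

Definition csum (u : nat -> R[i]) : R[i] :=
  (limn (series (fun k => complex.Re (u k))) +i*
   limn (series (fun k => complex.Im (u k))))%C.

Definition csummable (u : nat -> R[i]) : Prop :=
  cvgn (series (fun k => complex.Re (u k))) /\
  cvgn (series (fun k => complex.Im (u k))).

Lemma limn_seriesD (u v : nat -> R) : cvgn (series u) -> cvgn (series v) ->
  limn (series (fun k => u k + v k)) = limn (series u) + limn (series v).
Proof.
move=> cu cv; apply: cvg_lim => //.
have -> : series (fun k => u k + v k) = series u \+ series v.
  by apply: funext => n; rewrite /series /= big_split.
exact: cvgD.
Qed.

Lemma is_cvg_seriesZr (a : R) (u : nat -> R) : cvgn (series u) ->
  series (fun k => a * u k) @ \oo --> a * limn (series u).
Proof.
move=> cu; have -> : series (fun k => a * u k) = (fun n => a * series u n).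
  by apply: funext => n; rewrite /series /= mulr_sumr.
exact: cvgMl_tmp.
Qed.

Lemma csumD u v : csummable u -> csummable v ->
  csum (fun k => u k + v k) = csum u + csum v.
Proof.
move=> [u1 u2] [v1 v2]; rewrite /csum.
have -> : (fun k => complex.Re (u k + v k)) =
          (fun k => complex.Re (u k) + complex.Re (v k)).
  by apply: funext => k; case: (u k); case: (v k).
have -> : (fun k => complex.Im (u k + v k)) =
          (fun k => complex.Im (u k) + complex.Im (v k)).
  by apply: funext => k; case: (u k); case: (v k).
by rewrite !limn_seriesD.
Qed.

Lemma csumZ z u : csummable u -> csum (fun k => z * u k) = z * csum u.
Proof.
move=> [u1 u2]; rewrite /csum; case: z => a b.
have -> : (fun k => complex.Re ((a +i* b)%C * u k)) =
          (fun k => a * complex.Re (u k) + (- b) * complex.Im (u k)).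
  by apply: funext => k; case: (u k) => c d /=; rewrite mulNr.
have -> : (fun k => complex.Im ((a +i* b)%C * u k)) =
          (fun k => a * complex.Im (u k) + b * complex.Re (u k)).
  by apply: funext => k; case: (u k) => c d /=.
have cz (c : R) (w : nat -> R) : cvgn (series w) -> cvgn (series (fun k => c * w k)).
  by move=> cw; apply/cvg_ex; exists (c * limn (series w)); exact: is_cvg_seriesZr.
have lz (c : R) (w : nat -> R) : cvgn (series w) ->
    limn (series (fun k => c * w k)) = c * limn (series w).
  by move=> cw; apply: cvg_lim => //; exact: is_cvg_seriesZr.
rewrite !limn_seriesD; try exact: cz.
rewrite !lz //; apply/eqP; rewrite eq_complex /=.
by apply/andP; split; apply/eqP; ring.
Qed.

Lemma csum_conj u : csummable u ->
  csum (fun k => Num.conj (u k)) = Num.conj (csum u).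
Proof.
move=> [u1 u2]; rewrite /csum.
have -> : (fun k => complex.Re (Num.conj (u k))) = (fun k => complex.Re (u k)).
  by apply: funext => k; case: (u k).
have -> : (fun k => complex.Im (Num.conj (u k))) = (fun k => -1 * complex.Im (u k)).
  by apply: funext => k; case: (u k) => a b; rewrite mulN1r.
have -> : limn (series (fun k => -1 * complex.Im (u k))) =
          -1 * limn (series (fun k => complex.Im (u k))).
  by apply: cvg_lim => //; exact: is_cvg_seriesZr.
by rewrite mulN1r.
Qed.

Lemma csummable_rdot f g : csummable (fun k => rdot (f k) (g k)).
Proof.
have cfg : cvgn (series (fun k => rsq (f k) + rsq (g k))).
  have -> : series (fun k => rsq (f k) + rsq (g k)) =
      series (fun k => rsq (f k)) \+ series (fun k => rsq (g k)).
    by apply: funext => n; rewrite /series /= big_split.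
  by apply: is_cvgD; apply: l2_cvg; exact: l2P.
have bound (w : nat -> R) : (forall k, `|w k| <= rsq (f k) + rsq (g k)) ->
    cvgn (series w).
  move=> H; apply: normed_cvg; apply: (@series_le_cvg R (fun k => `|w k|)
    (fun k => rsq (f k) + rsq (g k))) => // k.
  by rewrite addr_ge0// rsq_ge0.
by split; apply: bound => k; have [] := rdot_bounds (f k) (g k).
Qed.

Definition l2dot f g : R[i] := csum (fun k => rdot (f k) (g k)).

Lemma l2dotPl g : linear_for *%R (l2dot^~ g).
Proof.
move=> a f f'; rewrite /l2dot.
under eq_fun do rewrite rdotDl rdotZl.
rewrite csumD; last exact: csummable_rdot.
  by rewrite csumZ//; exact: csummable_rdot.
have := csummable_rdot (a *: f) g; rewrite /csummable.
by under eq_fun do rewrite rdotZl;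
  under [X in _ /\ cvgn (series X)]eq_fun do rewrite rdotZl.
Qed.

Lemma l2dotC f g : l2dot f g = (-1) ^+ false * Num.conj (l2dot g f).
Proof.
rewrite expr0 mul1r /l2dot -csum_conj; last exact: csummable_rdot.
by under eq_fun do rewrite rdotC.
Qed.

Lemma l2dotPr f : linear_for (Num.conj \; *%R) (l2dot f).
Proof.
move=> a g g'; rewrite l2dotC expr0 mul1r l2dotPl rmorphD rmorphM /=.
by rewrite [l2dot f g]l2dotC [l2dot f g']l2dotC !expr0 !mul1r.
Qed.

Lemma l2dot_normE f : l2dot f f = `|f| ^+ 2.
Proof.
rewrite l2_normsq /l2dot /csum.
under eq_fun do rewrite rdot_self;
  under [X in (_ +i* limn (series X))%C]eq_fun do rewrite rdot_self.
rewrite /nsq /real_complex_def /=; congr (_ +i* _)%C.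
apply: cvg_lim => //; rewrite (_ : series _ = cst 0); first exact: cvg_cst.
by apply: funext => n; rewrite /series /= big1.
Qed.

Lemma l2dot_gt0 f : f != 0 -> 0 < l2dot f f.
Proof. by move=> f0; rewrite l2dot_normE exprn_gt0// normr_gt0. Qed.

HB.instance Definition _ := bilinear_isBilinear.Build R[i] l2 l2 R[i]
  ( *%R ) (Num.conj \; *%R) l2dot (l2dotPl, l2dotPr).
HB.instance Definition _ := isHermitianSesquilinear.Build R[i] l2 false
  Num.conj l2dot l2dotC.
HB.instance Definition _ := isDotProduct.Build R[i] l2 l2dot l2dot_gt0.

Definition l2H : hilbertSpace R := @HilbertSpace R l2 l2dot l2dot_normE.

End SquareSummable.

(** * Polynomial approximation of real powers *)

Section Bernstein.
Variable R : realType.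
Implicit Types (g h : nat -> R) (s t : R).

(* The Bernstein polynomial is the mean of [g] under a binomial law; the
   recursion conditions on the first trial, which avoids binomial coefficients
   and gives the second moment by induction. *)
Fixpoint bernstein (n : nat) g : {poly R} :=
  if n is n'.+1 then
    (1 - 'X) * bernstein n' g + 'X * bernstein n' (fun k => g k.+1)
  else (g 0%N)%:P.

Lemma bernsteinS n g s : (bernstein n.+1 g).[s] =
  (1 - s) * (bernstein n g).[s] + s * (bernstein n (fun k => g k.+1)).[s].
Proof. by rewrite /= !hornerE. Qed.

Lemma le_bernstein n g h s : 0 <= s <= 1 ->
  (forall k, (k <= n)%N -> g k <= h k) ->
  (bernstein n g).[s] <= (bernstein n h).[s].
Proof.
move=> /andP[s0 s1]; elim: n g h => [|n IH] g h gh.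
  by rewrite /= !hornerE gh.
rewrite !bernsteinS; apply: lerD; apply: ler_wpM2l; rewrite ?subr_ge0//.
  by apply: IH => k kn; apply: gh; apply: leqW.
by apply: IH => k kn; apply: gh.
Qed.

(** The shift a is there for the induction: after a success it becomes a + 1. At a = -ns only the
    binomial variance ns(1 - s) is left. *)
Lemma bernstein_quadratic n (c d a s : R) :
  (bernstein n (fun k => c + d * (k%:R + a) ^+ 2)).[s] =
  c + d * ((n%:R * s + a) ^+ 2 + n%:R * s * (1 - s)).
Proof.
elim: n a => [|n IH] a; first by rewrite /= !hornerE; ring.
rewrite bernsteinS IH.
have -> : (fun k => c + d * (k.+1%:R + a) ^+ 2) =
          (fun k => c + d * (k%:R + (a + 1)) ^+ 2).
  by apply: funext => k; rewrite -natr1; ring.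
by rewrite IH -natr1; ring.
Qed.

(** From |y| <= eta + y^2/eta the deviation of f has a majorant quadratic in k, whose Bernstein mean
    is known exactly; no splitting into near and far points is needed. *)
Lemma bernstein_lipschitz (f : R -> R) (L eta s : R) n : 0 <= L -> 0 < eta ->
  (0 < n)%N -> 0 <= s <= 1 ->
  (forall x y, 0 <= x <= 1 -> 0 <= y <= 1 -> `|f x - f y| <= L * `|x - y|) ->
  `|(bernstein n (fun k => f (k%:R / n%:R))).[s] - f s| <=
  L * (eta + (eta * n%:R)^-1).
Proof.
move=> L0 eta0 n0 s01 fL; have /andP[s0 s1] := s01.
have nR : 0 < n%:R :> R by rewrite ltr0n.
pose a := - (n%:R * s); pose d := L / (eta * n%:R ^+ 2).
have d0 : 0 <= d by rewrite divr_ge0// mulr_ge0 ?exprn_ge0// ltW.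
have close k : (k <= n)%N ->
    `|f (k%:R / n%:R) - f s| <= L * eta + d * (k%:R + a) ^+ 2.
  move=> kn; apply: le_trans (fL _ _ _ s01) _.
    by rewrite divr_ge0//= ler_pdivrMr// mul1r ler_nat.
  set y := `|_|; have y0 : 0 <= y by apply: normr_ge0.
  have -> : d * (k%:R + a) ^+ 2 = L * (y ^+ 2 / eta).
    rewrite /y real_normK ?num_real// /d /a; field.
    by rewrite !lt0r_neq0.
  rewrite -mulrDr ler_wpM2l//.
  have -> : eta + y ^+ 2 / eta = (eta ^+ 2 + y ^+ 2) / eta by field; rewrite lt0r_neq0.
  by rewrite ler_pdivlMr//; have := sqr_ge0 (eta - y); nra.
have E c e : (bernstein n (fun k => c + e * (k%:R + a) ^+ 2)).[s] =
    c + e * (n%:R * s * (1 - s)).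
  by rewrite bernstein_quadratic /a addrN expr0n add0r.
have dn : d * (n%:R * s * (1 - s)) <= L * (eta * n%:R)^-1.
  have -> : d * (n%:R * s * (1 - s)) = L * (eta * n%:R)^-1 * (s * (1 - s)).
    by rewrite /d; field; rewrite !lt0r_neq0.
  rewrite ler_piMr//; last by nra.
  by rewrite mulr_ge0// invr_ge0 mulr_ge0// ltW.
rewrite mulrDr ler_norml; apply/andP; split.
  have lo k : (k <= n)%N ->
      (f s - L * eta) + (- d) * (k%:R + a) ^+ 2 <= f (k%:R / n%:R).
    by move=> /close; rewrite ler_norml => /andP[+ _]; lra.
  by have := le_bernstein s01 lo; rewrite E; lra.
have hi k : (k <= n)%N ->
    f (k%:R / n%:R) <= (f s + L * eta) + d * (k%:R + a) ^+ 2.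
  by move=> /close; rewrite ler_norml => /andP[_ +]; lra.
by have := le_bernstein s01 hi; rewrite E; lra.
Qed.

Lemma onem_expr_le (v : R) n : 0 <= v <= 1 -> 1 - v ^+ n <= n%:R * (1 - v).
Proof.
move=> /andP[v0 v1]; elim: n => [|n IH]; first by rewrite expr0 subrr mul0r.
have p0 : 0 <= v ^+ n by rewrite exprn_ge0.
have p1 : v ^+ n <= 1 by rewrite exprn_ile1.
by rewrite exprS -natr1; nra.
Qed.

(* For [v = s / r] and an integer [n >= t], [r^t - s^t = r^t (1 - v^t)] is at
   most [r (1 - v^n) <= n (r - s)]. *)
Lemma powR_lipschitz t (n : nat) : 1 <= t -> t <= n%:R ->
  forall x y : R, 0 <= x <= 1 -> 0 <= y <= 1 ->
  `|x `^ t - y `^ t| <= n%:R * `|x - y|.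
Proof.
move=> t1 tn.
have t0 : 0 <= t by lra.
move=> x y.
wlog yx : x y / y <= x => [H X Y|].
  case: (leP y x) => [yx|/ltW xy]; first exact: H.
  by rewrite distrC (distrC x); apply: H.
move=> /andP[x0 x1] /andP[y0 y1].
have py : y `^ t <= x `^ t by apply: ge0_ler_powR; rewrite ?nnegrE.
rewrite !ger0_norm ?subr_ge0//.
have [X0|X0] := eqVneq x 0.
  have -> : y = x by lra.
  by rewrite !subrr mulr0.
have {}x0 : 0 < x by rewrite lt_def X0.
pose v := y / x.
have v01 : 0 <= v <= 1 by rewrite divr_ge0 ?(ltW x0)//= ler_pdivrMr// mul1r.
have /andP[v0 v1] := v01.
have yE : y = v * x by rewrite /v divfK.
have xt : x `^ t <= x.
  by rewrite -[leRHS]powRr1 ?(ltW x0)//; apply: ger_powR => //; rewrite x0.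
have xt0 := powR_ge0 x t.
have vt : v ^+ n <= v `^ t.
  have [->|vn0] := eqVneq v 0.
    rewrite powR0; last by lra.
    case: n tn {yE} => [|n] tn; first by move: tn t1; rewrite mulr0n; lra.
    by rewrite expr0n.
  by rewrite -powR_mulrn//; apply: ger_powR => //; rewrite lt_def vn0 v0.
have vt1 : v `^ t <= 1.
  by have := @ge0_ler_powR R t t0 v 1; rewrite powR1 !nnegrE => -> //.
rewrite yE powRM// ?(ltW x0)//.
have := onem_expr_le n v01.
have n0 : 0 <= n%:R :> R by [].
have -> : n%:R * (x - v * x) = x * (n%:R * (1 - v)) by ring.
move=> H; apply: (@le_trans _ _ (x `^ t * (1 - v `^ t))); first lra.
by apply: ler_pM => //; lra.
Qed.

Lemma powR_poly_approx t : 1 <= t ->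
  exists p : nat -> {poly R}, forall eps : R, 0 < eps -> \forall n \near \oo,
    forall s, 0 <= s <= 1 -> `|(p n).[s] - s `^ t| <= eps.
Proof.
move=> t1; have t0 : 0 <= t by lra.
pose N := Num.Def.archi_bound t.
have tN : t <= N%:R by apply: ltW; exact: archi_boundP.
have L1 : 1 <= N%:R :> R by apply: le_trans t1 tN.
exists (fun n => bernstein n (fun k => (k%:R / n%:R) `^ t)) => eps eps0.
pose eta := eps / (2 * N%:R).
have N0 : 0 < N%:R :> R by lra.
have eta0 : 0 < eta by rewrite divr_gt0// mulr_gt0.
have Ee : N%:R * (eta + eta) = eps by rewrite /eta; field; rewrite lt0r_neq0.
(* For n >= eta^-2 the error term (eta n)^-1 is at most eta, and N (eta + eta) = eps. The successor
   below keeps n positive. *)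
clearbody eta; pose M := Num.Def.archi_bound (eta ^- 2).
exists M.+1 => // n /= Mn s s01.
have n0 : (0 < n)%N by apply: leq_trans Mn.
apply: le_trans (bernstein_lipschitz (f := fun s => s `^ t) (ltW N0) eta0 n0 s01
  (powR_lipschitz t1 tN)) _.
have nM : eta ^- 2 <= n%:R.
  apply: (@le_trans _ _ M%:R).
    by apply: ltW; apply: archi_boundP; rewrite invr_ge0 exprn_ge0// ltW.
  by rewrite ler_nat ltnW.
have nR : 0 < n%:R :> R by rewrite ltr0n.
have H : (eta * n%:R)^-1 <= eta.
  rewrite -[leRHS]invrK lef_pV2 ?posrE ?invr_gt0 ?mulr_gt0//.
  have E2 : eta * eta ^- 2 = eta^-1 by field; rewrite lt0r_neq0.
  by have := ler_wpM2l (ltW eta0) nM; rewrite E2.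
apply: (@le_trans _ _ (N%:R * (eta + eta))); last by rewrite Ee.
by rewrite ler_wpM2l ?(ltW N0)// lerD2l.
Qed.

End Bernstein.

(** * Diagonal operators and their functional calculus *)

Lemma bounded_linear_continuousP (K : numFieldType) (V W : normedModType K)
    (f : {linear V -> W}) (C : K) :
  0 < C -> (forall x, `|f x| <= C * `|x|) -> continuous f.
Proof.
move=> C0 fC x; apply/cvgrPdist_lt => e e0; near=> y.
rewrite -raddfB; apply: le_lt_trans (fC _) _.
rewrite -ltr_pdivlMl//; near: y; apply: cvgr_dist_lt => //.
by rewrite mulr_gt0// invr_gt0.
Unshelve. all: by end_near. Qed.

Section DiagonalOperator.
Variables (R : realType) (m : nat).
Local Notation l2 := (l2 R m).
Implicit Types (x y f g : l2) (C : R).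

Section Bounded.
Variables (d : nat -> R) (C : R).
Hypothesis dC : forall k, `|d k| <= C.

Lemma diag_bound f N :
  \sum_(k < N) rsq ((d k)%:C%C *: f k) <= C ^+ 2 * nsq f.
Proof.
have C0 : 0 <= C := le_trans (normr_ge0 _) (dC 0%N).
apply: (@le_trans _ _ (\sum_(k < N) C ^+ 2 * rsq (f k))).
  apply: ler_sum => k _; rewrite rsqZ ler_wpM2r ?rsq_ge0//.
  rewrite /csq /= expr0n addr0 -(real_normK (num_real (d k))).
  by rewrite ler_sqr ?nnegrE.
by rewrite -mulr_sumr ler_wpM2l ?sqr_ge0// nsq_ub//; exact: l2P.
Qed.

Lemma diag_summable f : l2_summable (fun k => (d k)%:C%C *: f k).
Proof. by exists (C ^+ 2 * nsq f) => N; exact: diag_bound. Qed.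

(** Used with several bounded symbols: for A itself, its powers, its resolvents and the errors of
    polynomial approximation. *)
Definition diag f : l2 := toL2 (diag_summable f).

Lemma diagE f k : diag f k = (d k)%:C%C *: f k. Proof. by []. Qed.

Lemma diag_linear : linear diag.
Proof.
move=> a f g; apply: l2_ext => k.
by rewrite l2D l2Z !diagE l2D l2Z scalerDr !scalerA mulrC.
Qed.

HB.instance Definition _ := GRing.isLinear.Build R[i] l2 l2 *:%R diag diag_linear.

Lemma diag_norm_le f : `|diag f| <= C%:C%C * `|f|.
Proof.
have C0 : 0 <= C := le_trans (normr_ge0 _) (dC 0%N).
rewrite [X in _ <= _ * X]l2_normE -rmorphM /=; apply: l2norm_le => [|N].
  by rewrite mulr_ge0// sqrtr_ge0.
by rewrite exprMn sqr_sqrtr ?l2_nsq_ge0//; exact: diag_bound.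
Qed.

Lemma diag_continuous : continuous diag.
Proof.
have C0 : 0 <= C := le_trans (normr_ge0 _) (dC 0%N).
have C1 : 0 < (C + 1)%:C%C :> R[i] by rewrite ltcR; lra.
apply: (@bounded_linear_continuousP R[i] l2 l2 diag _ C1) => f.
apply: le_trans (diag_norm_le _) _; apply: ler_wpM2r => //; rewrite lecR; lra.
Qed.

End Bounded.

Definition lam (k : nat) : R := expR (- rate k).

Lemma lam_gt0 k : 0 < lam k. Proof. exact: expR_gt0. Qed.

Lemma lam_lt1 k : lam k < 1.
Proof. by rewrite expR_lt1 oppr_lt0 rate_gt0. Qed.

Lemma lam_norm_le1 k : `|lam k| <= 1.
Proof. by rewrite ger0_norm ?(ltW (lam_gt0 k))// ltW// lam_lt1. Qed.

Lemma lam_inj : injective lam.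
Proof.
move=> j k /expR_inj/oppr_inj; rewrite /rate => E.
have [jk|kj|//] := ltngtP j k.
  have : 16^-1 ^+ k.+2 < 16^-1 ^+ j.+2 :> R by rewrite ltr_iXn2l//; lra.
  by rewrite E ltxx.
have : 16^-1 ^+ j.+2 < 16^-1 ^+ k.+2 :> R by rewrite ltr_iXn2l//; lra.
by rewrite E ltxx.
Qed.

Lemma lam_powR k t : lam k `^ t = expR (- (t * rate k)).
Proof. by rewrite /lam -expRM; congr expR; ring. Qed.

Definition opA : {linear l2 -> l2} := diag lam_norm_le1.

Lemma opAE f k : opA f k = (lam k)%:C%C *: f k. Proof. by []. Qed.

Lemma opA_contractive : contractive (H := l2H R m) opA.
Proof. by move=> f; have := diag_norm_le lam_norm_le1 f; rewrite mul1r. Qed.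

Lemma l2_sumE (I : Type) (s : seq I) (F : I -> l2) k :
  (\sum_(i <- s) F i) k = \sum_(i <- s) F i k.
Proof. by elim/big_rec2: _ => [//|i v f _ <-]; rewrite l2D. Qed.

Lemma iter_opA n f k : iter n opA f k = (lam k ^+ n)%:C%C *: f k.
Proof.
elim: n => [|n IH]; first by rewrite expr0 scale1r.
by rewrite iterS opAE IH scalerA exprS -rmorphM.
Qed.

Lemma poly_opE (p : {poly R}) f k :
  poly_op (H := l2H R m) p opA f k = (p.[lam k])%:C%C *: f k.
Proof.
rewrite /poly_op l2_sumE horner_coef (raddf_sum (real_complex R)) scaler_suml.
apply: eq_bigr => i _; rewrite l2Z iter_opA scalerA.
by congr (_ *: _); rewrite -rmorphM.
Qed.

Definition coord_vec (k : nat) (v : 'rV[R[i]]_m) : nat -> 'rV[R[i]]_m :=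
  fun j => if j == k then v else 0.

Lemma coord_vec_summable k v : l2_summable (coord_vec k v).
Proof.
exists (rsq v) => N.
have [kN|Nk] := ltnP k N; last first.
  rewrite big1 ?rsq_ge0// => j _; rewrite /coord_vec ifF ?rsq0//.
  by apply/negbTE; rewrite neq_ltn (leq_trans (ltn_ord j)).
rewrite (bigD1 (Ordinal kN))//= /coord_vec eqxx big1 ?addr0// => j jk.
by rewrite ifF ?rsq0//; apply/negbTE.
Qed.

Definition single k v : l2 := toL2 (coord_vec_summable k v).

Lemma singleE k v j : single k v j = if j == k then v else 0.
Proof. by []. Qed.

Definition basis (p : nat * 'I_m) : l2 := single p.1 (delta_mx 0 p.2).

Lemma opA_single k v : opA (single k v) = (lam k)%:C%C *: single k v.
Proof.
apply: l2_ext => j; rewrite opAE l2Z !singleE.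
by case: eqP => [->//|_]; rewrite !scaler0.
Qed.

Lemma single_sum k (c : 'I_m -> R[i]) :
  \sum_(i < m) c i *: basis (k, i) = single k (\row_i c i).
Proof.
apply: l2_ext => j; rewrite l2_sumE singleE.
case: eqP => [->|/eqP/negbTE jk]; last first.
  by rewrite big1// => i _; rewrite l2Z singleE jk scaler0.
rewrite [RHS]row_sum_delta; apply: eq_bigr => i _.
by rewrite l2Z singleE eqxx mxE.
Qed.

Lemma csum_single (u : nat -> R[i]) k : (forall j, j != k -> u j = 0) ->
  csum u = u k.
Proof.
move=> uk.
have real (w : nat -> R) : (forall j, j != k -> w j = 0) -> limn (series w) = w k.
  move=> wk; apply: cvg_lim => //; apply: cvg_near_cst; exists k.+1 => // n /= kn.
  rewrite /series /= big_mkord (bigD1 (Ordinal kn))//= big1 ?addr0// => j jk.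
  exact: wk.
rewrite /csum !real => [|j /uk ->//|j /uk ->//].
by case: (u k).
Qed.

Lemma l2dot_single x k v : l2dot x (single k v) = rdot (x k) v.
Proof.
rewrite /l2dot (@csum_single _ k) => [|j jk].
  by rewrite /= /coord_vec eqxx.
rewrite singleE (negbTE jk) /rdot big1// => i _.
by rewrite mxE rmorph0 mulr0.
Qed.

Lemma rdot_delta (v : 'rV[R[i]]_m) (i : 'I_m) : rdot v (delta_mx 0 i) = v 0 i.
Proof.
rewrite /rdot (bigD1 i)//= mxE !eqxx rmorph1 mulr1 big1 ?addr0// => j ji.
by rewrite mxE eqxx (negbTE ji) rmorph0 mulr0.
Qed.

Lemma l2dot_basis x p : l2dot x (basis p) = x p.1 0 p.2.
Proof. by rewrite l2dot_single rdot_delta. Qed.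

Lemma basis_orthonormal p q : l2dot (basis p) (basis q) = (p == q)%:R.
Proof.
case: p q => [j i] [k i']; rewrite l2dot_basis /basis singleE xpair_eqE /=.
by rewrite (eq_sym k) (eq_sym i); case: eqP => _; rewrite mxE ?eqxx.
Qed.

End DiagonalOperator.

Section FunctionalCalculus.
Variables (R : realType) (m : nat).
Hypothesis m_gt0 : (0 < m)%N.
Local Notation l2 := (l2 R m).
Local Notation H := (l2H R m).
Local Notation A := (@opA R m).
Local Notation lam := (@lam R).
Implicit Types (x y f g : l2) (t s : R).

Lemma delta_neq0 (i : 'I_m) : delta_mx 0 i != 0 :> 'rV[R[i]]_m.
Proof.
apply/eqP => /rowP/(_ i); rewrite !mxE !eqxx /=.
by move/eqP; rewrite oner_eq0.
Qed.

Lemma basis_neq0 (p : nat * 'I_m) : basis R p != 0.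
Proof.
apply: contraNneq (delta_neq0 p.2) => b0.
by have /(congr1 (fun f : l2 => f p.1)) := b0; rewrite singleE eqxx => ->.
Qed.

Lemma lam_spectrum k : spectrum (H := H) A (lam k)%:C%C.
Proof.
move=> [B [_ BA _]]; pose p := (k, Ordinal m_gt0).
have := BA (basis R p); rewrite opA_single subrr raddf0 => /esym/eqP.
exact/negP/basis_neq0.
Qed.

(** For real s outside [0, 1] the distance from s to the eigenvalues is bounded below, so the
    diagonal operator with entries 1/(lam k - s) is a continuous inverse. *)
Lemma spectrum_itv s : spectrum (H := H) A s%:C%C -> 0 <= s <= 1.
Proof.
move=> sp; apply: contrapT => s01; apply: sp.
have [e e0 es] : exists2 e : R, 0 < e & forall k, e <= `|lam k - s|.
  have [s0|s0] := ltP s 0.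
    exists (- s) => [|k]; first by lra.
    by have := @lam_gt0 R k; rewrite ler_normr => l0; apply/orP; left; lra.
  have [s1|s1] := ltP 1 s; last by case: s01; rewrite s0.
  exists (s - 1) => [|k]; first by lra.
  by have := @lam_lt1 R k; rewrite ler_normr => l1; apply/orP; right; lra.
have nz k : lam k - s != 0 by rewrite -normr_gt0; apply: lt_le_trans (es k).
have bd k : `|(lam k - s)^-1| <= e^-1.
  by rewrite normfV lef_pV2 ?posrE ?normr_gt0.
have E x k : (A x - s%:C%C *: x) k = (lam k - s)%:C%C *: x k.
  by rewrite l2B l2Z opAE -scalerBl rmorphB.
exists (diag bd); split.
- exact: diag_continuous.
- move=> x; apply: l2_ext => k.
  by rewrite diagE E scalerA -rmorphM /= mulVf// scale1r.
- move=> x; apply: l2_ext => k.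
  by rewrite E diagE scalerA -rmorphM /= mulfV// scale1r.
Qed.

Lemma lam_powR_norm_le1 t k : 0 <= t -> `|lam k `^ t| <= 1.
Proof.
move=> t0; rewrite ger0_norm ?powR_ge0// lam_powR expRN_le1//.
by rewrite mulr_ge0// ltW// rate_gt0.
Qed.

(** Uniform approximation on [0, 1] serves twice: it covers the spectrum, and it bounds the entries
    of the diagonal operator that is the error in norm. *)
Lemma is_fun_calc_powR t (t0 : 0 <= t) : 1 <= t ->
  is_fun_calc (H := H) A (fun s => s `^ t)
    (diag (fun k => lam_powR_norm_le1 k t0)).
Proof.
move=> t1; have [p pP] := powR_poly_approx t1; exists p; split=> eps eps0.
  by apply: filterS (pP _ eps0) => n pn s /spectrum_itv; exact: pn.
apply: filterS (pP _ eps0) => n pn x.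
have dn k : `|(p n).[lam k] - lam k `^ t| <= eps.
  by apply: pn; rewrite (ltW (lam_gt0 _ k)) (ltW (lam_lt1 _ k)).
have -> : poly_op (H := H) (p n) A x - diag (fun k => lam_powR_norm_le1 k t0) x
    = diag dn x.
  by apply: l2_ext => k; rewrite l2B poly_opE !diagE -scalerBl rmorphB.
exact: diag_norm_le.
Qed.

Lemma norm_row_le x k (e : R) : 0 <= e -> `|x| <= e%:C%C -> rsq (x k) <= e ^+ 2.
Proof.
move=> e0; rewrite l2_normE lecR => xe.
apply: le_trans (rsq_le_nsq k (l2P x)) _.
rewrite -[nsq x]sqr_sqrtr ?l2_nsq_ge0// ler_sqr ?nnegrE ?sqrtr_ge0//.
Qed.

(** Uniqueness, whichever polynomials p_n are used: as [lam k] is in the spectrum, p_n(lam k) tends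
    to f(lam k), while row k of p_n(A)x tends to row k of Bx. *)
Lemma is_fun_calcE (f : R -> R) (B : l2 -> l2) x k :
  is_fun_calc (H := H) A f B -> B x k = (f (lam k))%:C%C *: x k.
Proof.
move=> [p [p1 p2]]; apply/eqP; rewrite -subr_eq0; apply/eqP/rsq_eq0/eqP.
set w := B x k - _.
pose X := Num.sqrt (nsq x).
have X0 : 0 <= X by apply: sqrtr_ge0.
have small (e : R) : 0 < e -> rsq w <= 4 * e ^+ 2 * nsq x.
  move=> e0.
  have [n [n1 n2]] := filter_ex (filterI (p1 _ e0) (p2 _ e0)).
  have {}n1 := n1 _ (@lam_spectrum k).
  have : rsq ((poly_op (H := H) (p n) A x - B x) k) <= (e * X) ^+ 2.
    apply: norm_row_le; first by rewrite mulr_ge0// ltW.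
    by rewrite rmorphM; exact: n2.
  rewrite l2B poly_opE -rsqN opprB => H1.
  have -> : w = (B x k - ((p n).[lam k])%:C%C *: x k) +
      ((p n).[lam k] - f (lam k))%:C%C *: x k.
    by rewrite /w rmorphB scalerBl addrA subrK.
  apply: le_trans (rsqD_le _ _ ltr01) _.
  have E : X ^+ 2 = nsq x by rewrite sqr_sqrtr// l2_nsq_ge0.
  rewrite exprMn E in H1.
  have H2 : rsq (((p n).[lam k] - f (lam k))%:C%C *: x k) <= e ^+ 2 * nsq x.
    rewrite rsqZ; apply: ler_pM; rewrite ?csq_ge0 ?rsq_ge0//; last first.
      exact/rsq_le_nsq/l2P.
    rewrite /csq /= expr0n addr0 -(real_normK (num_real (_ - _))).
    by rewrite ler_sqr ?nnegrE// ltW.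
  by rewrite invr1; lra.
apply/negPn/negP => w0.
have wp : 0 < rsq w by rewrite lt_def w0 rsq_ge0.
have x2 := l2_nsq_ge0 x.
(* With e^2 equal to this value the bound 4 e^2 [nsq x] is at most half of [rsq w]; the added 1
   keeps the denominator positive for x = 0. *)
pose e2 := rsq w / (8 * (nsq x + 1)).
have e20 : 0 < e2 by rewrite divr_gt0// mulr_gt0//; lra.
have := small (Num.sqrt e2); rewrite sqrtr_gt0 sqr_sqrtr ?(ltW e20)// => /(_ e20).
have E : e2 * (8 * (nsq x + 1)) = rsq w by rewrite /e2 divfK// lt0r_neq0// mulr_gt0//;
  lra.
rewrite -E; nra.
Qed.

Lemma op_powE t f k : t = 0 \/ 1 <= t ->
  op_pow (H := H) A t f k = (lam k `^ t)%:C%C *: f k.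
Proof.
rewrite /op_pow; case: eqP => [-> _|t0 [//|t1]].
  by rewrite powRr0 scale1r.
apply: (@is_fun_calcE (fun s => s `^ t)); rewrite /fun_calc.
(* [xget] meets its specification only if some witness exists; the diagonal power is one. *)
apply: (@xgetPex _ _ [set B | is_fun_calc (H := H) A (fun s => s `^ t) B]).
have t0' : 0 <= t by lra.
by exists (diag (fun k => lam_powR_norm_le1 k t0')); exact: is_fun_calc_powR.
Qed.

Lemma opA_continuous : continuous A.
Proof. exact: diag_continuous. Qed.

End FunctionalCalculus.

(** * Separability and dense spans *)

Section Density.
Variables (R : realType) (m : nat).
Local Notation l2 := (l2 R m).
Local Notation H := (l2H R m).
Implicit Types (x y : l2).

Lemma l2_dense (S : set l2) :
  (forall x (e : R), 0 < e -> exists2 y, S y & nsq (x - y) < e) -> dense S.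
Proof.
move=> HS O [x Ox] oO.
have /nbhs_ballP[e /= e0 eO] : nbhs x O by exact: open_nbhs_nbhs.
have [e' E] : exists e' : R, e = e'%:C%C.
  by exists (complex.Re e); case: e e0 {eO} => a b; rewrite ltcE /= => /andP[/eqP-> _].
move: e0; rewrite E ltcR => e0.
have [y Sy xy] := HS x _ (exprn_gt0 2 e0).
exists y; split=> //; apply: eO; rewrite -ball_normE /= E l2_norm_lt.
by rewrite -(ger0_norm (ltW e0)) -sqrtr_sqr ltr_sqrt ?exprn_gt0.
Qed.

Definition finite_comb N (c : 'I_N * 'I_m -> R[i]) : l2 :=
  \sum_j c j *: basis R (val j.1, j.2).

Lemma finite_comb_in N (c : 'I_N * 'I_m -> R[i]) (k : 'I_N) i :
  finite_comb c k 0 i = c (k, i).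
Proof.
rewrite l2_sumE summxE (bigD1 (k, i))// l2Z /basis singleE eqxx !mxE !eqxx mulr1.
rewrite big1 => [|[k' i'] ne]; first exact: addr0.
rewrite l2Z /basis singleE /=.
case: (eqVneq (k : nat) k') => [/val_inj kk|_]; last by rewrite !mxE mulr0.
rewrite !mxE eqxx /=; case: (eqVneq i i') => [ii|_]; last by rewrite mulr0.
by rewrite -kk -ii eqxx in ne.
Qed.

Lemma finite_comb_out N (c : 'I_N * 'I_m -> R[i]) k : (N <= k)%N ->
  finite_comb c k = 0.
Proof.
move=> Nk; rewrite l2_sumE big1// => -[k' i'] _; rewrite l2Z /basis singleE /=.
by rewrite gtn_eqF ?scaler0// (leq_trans (ltn_ord k')).
Qed.

Lemma nsq_finite_comb N (c : 'I_N * 'I_m -> R[i]) x :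
  nsq (x - finite_comb c) <=
  \sum_(k < N) \sum_(i < m) csq (x k 0 i - c (k, i)) +
  (nsq x - \sum_(k < N) rsq (x k)).
Proof.
apply: nsq_lub => N'.
set y := finite_comb c.
apply: (@le_trans _ _ (\sum_(k < N + N') rsq ((x - y) k))).
  rewrite -!(big_mkord xpredT (fun k => rsq ((x - y) k))).
  rewrite [leRHS](big_cat_nat (leq0n N') (leq_addl _ _))/= lerDl.
  by apply: sumr_ge0 => k _; exact: rsq_ge0.
rewrite big_split_ord; apply: lerD.
  apply: ler_sum => k _; apply: ler_sum => i _.
  by rewrite l2B -[csq (x _ _ _ - _)]/(csq (x (lshift N' k) 0 i - _)) !mxE (finite_comb_in c k i).
rewrite lerBrDr addrC; apply: le_trans (nsq_ub (N + N') (l2P x)).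
rewrite [leRHS]big_split_ord lerD2l; apply: ler_sum => k _.
by rewrite l2B finite_comb_out ?subr0//= leq_addr.
Qed.

Definition ratc (r : rat * rat) : R[i] := (ratr r.1 +i* ratr r.2)%C.

Lemma ratc_approx (z : R[i]) (h : R) : 0 < h ->
  exists r, csq (z - ratc r) <= 2 * h ^+ 2.
Proof.
move=> h0; case: z => a b.
have approx (c : R) : exists q : rat, (c - ratr q) ^+ 2 <= h ^+ 2.
  have [q] := @rat_in_itvoo R (c - h) (c + h) ltac:(lra).
  rewrite in_itv /= => /andP[q1 q2]; exists q.
  rewrite -[leLHS]real_normK ?num_real// ler_sqr ?nnegrE ?(ltW h0)//.
  by rewrite ler_norml; apply/andP; split; lra.
have [q1 H1] := approx a; have [q2 H2] := approx b.
by exists (q1, q2); rewrite /csq /=; lra.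
Qed.

(** These combinations serve twice: there are countably many of them, which gives separability, and
    they lie in the span of the basis, which makes it dense. *)
Lemma rational_approx x (e : R) : 0 < e ->
  exists (N : nat) (q : {ffun 'I_N * 'I_m -> rat * rat}),
    nsq (x - finite_comb (fun j => ratc (q j))) < e.
Proof.
move=> e0; have e20 : 0 < e / 2 by rewrite divr_gt0.
have [N Nx] : exists N, nsq x - \sum_(k < N) rsq (x k) < e / 2.
  have /cvgrPdist_lt/(_ _ e20)[N _ /(_ N (leqnn N))] := l2_cvg (l2P x).
  rewrite /= -/(nsq x) /series /= big_mkord => Hn; exists N.
  by apply: le_lt_trans Hn; exact: ler_norm.
(* Each of the N m coordinates costs 2 h^2 = 2 e / D, together at most e/2; the other half is for
   the tail. *)
pose D : R := 4 * (N * m).+1%:R.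
have D0 : 0 < D by rewrite mulr_gt0.
pose h := Num.sqrt (e / D).
have h2 : h ^+ 2 = e / D by rewrite sqr_sqrtr// divr_ge0// ltW.
have h0 : 0 < h by rewrite sqrtr_gt0 divr_gt0.
have /choice[q qP] : forall j : 'I_N * 'I_m, exists r, csq (x j.1 0 j.2 - ratc r)
  <= 2 * h ^+ 2.
  by move=> j; exact: ratc_approx.
exists N, [ffun j => q j]; apply: le_lt_trans (nsq_finite_comb _ _) _.
have : \sum_(k < N) \sum_(i < m) csq (x k 0 i - ratc ([ffun j => q j] (k, i))) <= e / 2.
  apply: (@le_trans _ _ (\sum_(k < N) \sum_(i < m) (2 * h ^+ 2))).
    by apply: ler_sum => k _; apply: ler_sum => i _; rewrite ffunE; exact: (qP (k, i)).
  rewrite !sumr_const !card_ord -mulrnA -[leLHS]mulr_natl h2.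
  have -> : (m * N)%:R * (2 * (e / D)) = (e / 2) * ((m * N)%:R / (N * m).+1%:R).
    have M0 : (N * m).+1%:R != 0 :> R by rewrite pnatr_eq0.
    by rewrite /D; move: ((N * m).+1%:R) M0 => M M0; field.
  rewrite ler_piMr ?(ltW e20)// ler_pdivrMr// mul1r ler_nat mulnC.
  exact: leqnSn.
lra.
Qed.

Lemma l2_separable : separable H.
Proof.
pose g (p : {N : nat & {ffun 'I_N * 'I_m -> rat * rat}}) : l2 :=
  finite_comb (fun j => ratc (tagged p j)).
exists (range g).
  by apply: sub_countable (countableP setT); exact: card_image_le.
apply: l2_dense => x e e0; have [N [q qP]] := rational_approx x e0.
by exists (g (Tagged (fun N => {ffun 'I_N * 'I_m -> rat * rat}) q)) => //;
  exists (Tagged _ q).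
Qed.

Lemma lin_span_fin (J : finType) (I : choiceType) (e : I -> l2) (phi : J -> I)
    (c : J -> R[i]) : injective phi ->
  lin_span (H := H) e (\sum_j c j *: e (phi j)).
Proof.
move=> phi_inj; exists [seq phi j | j <- enum J].
exists (fun i => if [pick j | phi j == i] is Some j then c j else 0).
rewrite big_map big_enum; apply: eq_bigr => j _; case: pickP => [j' /eqP/phi_inj->//|].
by move=> /(_ j); rewrite eqxx.
Qed.

(** The reindexing phi allows both the pairs used for general m and the plain natural numbers used
    for m = 1. *)
Lemma lin_span_dense (I : choiceType) (e : I -> l2) (phi : nat * 'I_m -> I) :
  injective phi -> (forall p, e (phi p) = basis R p) ->
  dense (lin_span (H := H) e).
Proof.
move=> phi_inj eP; apply: l2_dense => x eps eps0.
have [N [q qP]] := rational_approx x eps0.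
exists (finite_comb (fun j => ratc (q j))) => //.
rewrite /finite_comb; under eq_bigr do rewrite -eP.
apply: (@lin_span_fin _ _ e (fun j : 'I_N * 'I_m => phi (val j.1, j.2))).
by move=> [k i] [k' i'] /phi_inj[/val_inj -> ->].
Qed.

End Density.

(** * The Carleson condition *)

Section Carleson.
Variable R : realType.
Local Notation lam := (@lam R).

Definition cfactor (k j : nat) : R := `|(lam k - lam j) / (1 - lam k * lam j)|.

Lemma onem_lamM_gt0 k j : 0 < 1 - lam k * lam j.
Proof.
have := @lam_lt1 R k; have := @lam_lt1 R j.
have := @lam_gt0 R k; have := @lam_gt0 R j; nra.
Qed.

Lemma cfactorC k j : cfactor k j = cfactor j k.
Proof. by rewrite /cfactor !normrM distrC [lam j * _]mulrC. Qed.

(** For k < j, 1 minus the factor equals (1 - lam j)(1 + lam k) / (1 - lam k lam j). The numerator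
    is at most 2 [rate j], the denominator at least 1 - lam k >= [rate k] / 2, and the ratio of the
    rates is 16^-d. *)
Lemma cfactor_ge k j : j != k -> 1 - 4 * 16^-1 ^+ dst j k <= cfactor k j.
Proof.
wlog kj : k j / (k < j)%N => [W jk|_].
  case: (ltngtP k j) => [kj|jk'|E]; [exact: W|rewrite cfactorC dstC|].
    by apply: W => //; rewrite eq_sym.
  by rewrite E eqxx in jk.
have D0 := onem_lamM_gt0 k j.
have lj1 := @lam_lt1 R j; have lk1 := @lam_lt1 R k.
have lj0 := @lam_gt0 R j; have lk0 := @lam_gt0 R k.
have rj0 := @rate_gt0 R j; have rk0 := @rate_gt0 R k.
have rk1 := @rate_le R k.
have E : rate j = rate k * 16^-1 ^+ dst j k :> R.
  rewrite /rate -exprD; congr (_ ^+ _).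
  by rewrite /dst; have := ltnW kj; lia.
have aj : 1 - lam j <= rate j.
  by have := expR_ge1Dx (- rate j : R); rewrite -/(lam j); lra.
have ak : rate k / 2 <= 1 - lam k.
  have /andP[_] := inv_1BexpR rk0; rewrite -/(lam k) => H.
  have d0 : 0 < 1 - lam k by lra.
  have : 1 <= ((rate k)^-1 + 1) * (1 - lam k) by rewrite -ler_pdivrMr// div1r.
  have -> : (rate k)^-1 + 1 = (1 + rate k) / rate k :> R.
    by field; rewrite lt0r_neq0.
  rewrite mulrAC ler_pdivlMr//; nra.
have sgn : lam k <= lam j by rewrite ler_expR lerN2 E ler_piMr ?(ltW rk0)// exprn_ile1//; lra.
rewrite /cfactor normrM distrC (ger0_norm (_ : 0 <= lam j - lam k)); last by lra.
rewrite ger0_norm; last by rewrite invr_ge0 ltW.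
rewrite ler_pdivlMr//.
have x0 : 0 <= 16^-1 ^+ dst j k :> R by rewrite expr_ge0V.
move: E; set x := _ ^+ dst j k in x0 * => E.
have : 4 * x * (1 - lam k * lam j) >= 4 * x * (1 - lam k).
  by rewrite ler_wpM2l; [|lra|nra].
nra.
Qed.

Lemma cfactor_le1 k j : cfactor k j <= 1.
Proof.
rewrite /cfactor normrM normfV (gtr0_norm (onem_lamM_gt0 k j)).
rewrite ler_pdivrMr ?onem_lamM_gt0// mul1r ler_norml.
have := @lam_lt1 R k; have := @lam_lt1 R j.
have := @lam_gt0 R k; have := @lam_gt0 R j.
by move=> *; apply/andP; split; nra.
Qed.

(** Weierstrass's product inequality; the upper bound is carried along because the inductive step
    for the lower one relies on it. *)
Lemma prodr_ge_onem (n : nat) (F : nat -> R) :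
  (forall j, 0 <= F j <= 1) ->
  1 - \sum_(j < n) (1 - F j) <= \prod_(j < n) F j <= 1.
Proof.
move=> F01; elim: n => [|n /andP[IH1 IH2]]; first by rewrite !big_ord0 subr0 lexx.
rewrite !big_ord_recr /=; have /andP[f0 f1] := F01 n.
have s0 : 0 <= \sum_(i < n) (1 - F i).
  by apply: sumr_ge0 => i _; have /andP[_] := F01 i; lra.
have p0 : 0 <= \prod_(i < n) F i by apply: prodr_ge0 => i _; have /andP[] := F01 i.
by apply/andP; split; nra.
Qed.

Lemma carleson_product_ge k : 7 / 15 <= carleson_product lam k.
Proof.
pose F j := if j != k then cfactor k j else 1.
have F01 j : 0 <= F j <= 1.
  by rewrite /F; case: ifP => _; rewrite ?cfactor_le1 ?normr_ge0 ?ler01 ?lexx.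
have E n : \prod_(0 <= j < n | j != k) cfactor k j = \prod_(j < n) F j.
  by rewrite big_mkcond big_mkord.
have pE : carleson_product lam k = limn (fun n => \prod_(j < n) F j).
  by rewrite /carleson_product; congr (lim _); under eq_fun do rewrite E.
have lb n : 7 / 15 <= \prod_(j < n) F j.
  have /andP[+ _] := prodr_ge_onem n F01; apply: le_trans.
  pose D j : R := 16^-1 ^+ dst j k - (j == k)%:R.
  have FD j : 1 - F j <= 4 * D j.
    rewrite /F /D; case: eqVneq => [->|/cfactor_ge]; last by rewrite /= subr0; lra.
    by rewrite dstnn expr0 !subrr mulr0.
  have D0 j : 0 <= D j by have := FD j; have /andP[_] := F01 j; lra.
  (* The range is lengthened so as to contain k; then removing the diagonal term takes exactly 1
     from 17/15. The product is at least 1 - 4 * 2/15 = 7/15. *)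
  have DS : \sum_(j < n + k.+1) D j <= 2 / 15.
    have kn : (k < n + k.+1)%N by rewrite addnS ltnS leq_addl.
    rewrite sumrB; have -> : \sum_(i < n + k.+1) (i == k :> nat)%:R = 1 :> R.
      rewrite (bigD1 (Ordinal kn)) //= eqxx big1 ?addr0// => i /eqP ik.
      by case: eqP => // e; case: ik; apply: val_inj.
    have := @sum_dst_le R 16^-1 (n + k.+1) k (17 / 15) ltac:(lra) ltac:(lra); lra.
  have nS : \sum_(j < n) D j <= \sum_(j < n + k.+1) D j.
    by rewrite big_split_ord lerDl; apply: sumr_ge0 => j _; exact: D0.
  have : \sum_(j < n) (1 - F j) <= 4 * \sum_(j < n) D j.
    by rewrite mulr_sumr; apply: ler_sum => j _; exact: FD.
  lra.
rewrite pE; apply: limr_ge; last by near=> n; exact: lb.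
apply: nonincreasing_is_cvgn; last by exists (7 / 15) => _ [n _ <-]; exact: lb.
apply/nonincreasing_seqP => n; rewrite big_ord_recr /= ler_piMr//; last first.
  by have /andP[] := F01 n.
by apply: prodr_ge0 => j _; have /andP[] := F01 j.
Unshelve. all: by end_near. Qed.

Lemma carleson_inf_gt0 : 0 < inf (range (carleson_product lam)).
Proof.
have : 7 / 15 <= inf (range (carleson_product lam)).
  apply: lb_le_inf; first by exists (carleson_product lam 0), 0%N.
  by move=> _ [k _ <-]; exact: carleson_product_ge.
lra.
Qed.

End Carleson.

(** * Orbits of the diagonal operator *)

Section Orbits.
Variables (R : realType) (m : nat).
Hypothesis m_gt0 : (0 < m)%N.
Local Notation l2 := (l2 R m).
Local Notation H := (l2H R m).
Local Notation A := (@opA R m).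
Local Notation lam := (@lam R).
Implicit Types (x : l2) (t : R) (T : set R) (i : 'I_m).

Definition gen_seq i : nat -> 'rV[R[i]]_m :=
  fun k => (wt k)%:C%C *: delta_mx 0 i.

Lemma gen_summable i : l2_summable (gen_seq i).
Proof.
exists (rsq (delta_mx 0 i : 'rV[R[i]]_m)) => N.
under eq_bigr do rewrite rsqZ.
rewrite -mulr_suml ler_piMl ?rsq_ge0//.
apply: (@le_trans _ _ (\sum_(k < N) wt k)).
  apply: ler_sum => k _; rewrite /csq /= expr0n addr0.
  by have := @wt_gt0 R k; have := @wt_le R k; nra.
by have := @sum_wt_le R N; lra.
Qed.

Definition gen i : l2 := toL2 (gen_summable i).

Definition reseq x i k : R := complex.Re (x k 0 i).
Definition imseq x i k : R := complex.Im (x k 0 i).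

Lemma inner_orbit x i t : t = 0 \/ 1 <= t ->
  l2dot x (op_pow (H := H) A t (gen i)) =
  (sample t (reseq x i) +i* sample t (imseq x i))%C.
Proof.
move=> t01; rewrite /l2dot /csum /sample.
have E k : rdot (x k) (op_pow (H := H) A t (gen i) k) =
    x k 0 i * (ev t k)%:C%C.
  rewrite (op_powE m_gt0 _ _ t01) -[gen i k]/(gen_seq i k) /gen_seq scalerA.
  rewrite -rmorphM /= lam_powR /rdot (bigD1 i)//= !mxE !eqxx mulr1 big1.
    rewrite addr0; congr (_ * _); rewrite /ev mulrC.
    exact: conjc_real.
  move=> j ji; rewrite !mxE eqxx (negbTE ji) mulr0.
  by rewrite rmorph0 mulr0.
congr (limn (series _) +i* limn (series _))%C; apply: funext => k; rewrite E.
  by rewrite /reseq; case: (x k 0 i) => a b /=; rewrite mulr0 subr0.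
by rewrite /imseq; case: (x k 0 i) => a b /=; rewrite mulr0 add0r.
Qed.

Lemma sqr_seq_le x i N :
  \sum_(k < N) reseq x i k ^+ 2 <= nsq x /\
  \sum_(k < N) imseq x i k ^+ 2 <= nsq x.
Proof.
have le k : csq (x k 0 i) <= rsq (x k) by exact: csq_le_rsq.
by split; apply: le_trans (nsq_ub N (l2P x)); apply: ler_sum => k _;
  apply: le_trans (le k); rewrite /csq ?lerDl ?lerDr sqr_ge0.
Qed.

Definition sqlim (u : nat -> R) : R := limn (fun N => \sum_(k < N) u k ^+ 2).

Lemma sqlim_facts (u : nat -> R) (B : R) :
  (forall N, \sum_(k < N) u k ^+ 2 <= B) ->
  (\sum_(k < N) u k ^+ 2 @[N --> \oo] --> sqlim u) /\
  (forall N, \sum_(k < N) u k ^+ 2 <= sqlim u).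
Proof.
move=> uB.
have homo : {homo (fun N => \sum_(k < N) u k ^+ 2) : n p / (n <= p)%N >-> n <= p}.
  apply/nondecreasing_seqP => n; rewrite big_ord_recr /= lerDl sqr_ge0 //.
have c : cvgn (fun N => \sum_(k < N) u k ^+ 2).
  by apply: nondecreasing_is_cvgn => //; exists B => _ [N _ <-].
by split=> // N; exact: (nondecreasing_cvgn_le homo c).
Qed.

Lemma nsq_split x :
  nsq x = \sum_(i < m) (sqlim (reseq x i) + sqlim (imseq x i)).
Proof.
apply: cvg_lim => //.
have -> : series (fun k => rsq (x k)) =
    (fun N => \sum_(i < m) (\sum_(k < N) reseq x i k ^+ 2 +
                             \sum_(k < N) imseq x i k ^+ 2)).
  apply: funext => N; rewrite /series /= big_mkord exchange_big /=.
  by apply: eq_bigr => i _; rewrite -big_split.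
apply: cvg_sumr => i; apply: cvgD.
  by have [] := sqlim_facts (fun N => (sqr_seq_le x i N).1).
by have [] := sqlim_facts (fun N => (sqr_seq_le x i N).2).
Qed.

Lemma orbit_energyE T x : (forall t, T t -> t = 0 \/ 1 <= t) ->
  orbit_energy (H := H) T A gen x =
  (\sum_(i < m) (energy T (reseq x i) + energy T (imseq x i)))%E.
Proof.
move=> T01.
have -> : orbit_energy (H := H) T A gen x = \esum_(t in T) (\sum_(i < m)
    ((sample t (reseq x i) ^+ 2)%:E + (sample t (imseq x i) ^+ 2)%:E))%E.
  apply: eq_esum => t /T01 t01; apply: eq_bigr => i _.
  by rewrite -EFinD [inner _ _](inner_orbit x i t01) csqE.
rewrite esum_sum => [|t i _ _]; last by rewrite adde_ge0// lee_fin sqr_ge0.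
by apply: eq_bigr => i _; rewrite esumD// => t _; rewrite lee_fin sqr_ge0.
Qed.

Lemma Re_normsq x : complex.Re (`|x| ^+ 2) = nsq x.
Proof. by rewrite l2_normsq. Qed.

Lemma bessel_gen T (C : R) : (forall t, T t -> t = 0 \/ 1 <= t) ->
  (forall (u : nat -> R) B, (forall N, \sum_(k < N) u k ^+ 2 <= B) ->
     (energy T u <= (C * B)%:E)%E) ->
  bessel_orbit (H := H) T A gen.
Proof.
move=> T01 TC; exists C => x; rewrite orbit_energyE// Re_normsq nsq_split.
rewrite mulr_sumr -sumEFin; apply: lee_sum => i _; rewrite mulrDr EFinD.
apply: leeD; apply: TC.
  by have [] := sqlim_facts (fun N => (sqr_seq_le x i N).1).
by have [] := sqlim_facts (fun N => (sqr_seq_le x i N).2).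
Qed.

Lemma nat_times01 t : nat_times t -> t = 0 \/ 1 <= t.
Proof.
by move=> [[|n] _ <-]; [left|right; rewrite ler1n].
Qed.

Lemma frame_nat : frame_orbit (H := H) nat_times A gen.
Proof.
split; first exact: (bessel_gen nat_times01 (@nat_energy_upper R)).
exists (40^-1) => // x.
rewrite orbit_energyE; last exact: nat_times01.
rewrite Re_normsq nsq_split.
rewrite mulr_sumr -sumEFin; apply: lee_sum => i _; rewrite mulrDr EFinD.
apply: leeD; apply: nat_energy_ge_lower.
- by have [] := sqlim_facts (fun N => (sqr_seq_le x i N).1).
- by have [] := sqlim_facts (fun N => (sqr_seq_le x i N).1).
- by have [] := sqlim_facts (fun N => (sqr_seq_le x i N).2).
- by have [] := sqlim_facts (fun N => (sqr_seq_le x i N).2).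
Qed.

Lemma bessel_time c : 1 < c -> bessel_orbit (H := H) (time_set 16%:R c) A gen.
Proof.
move=> c1; apply: (@bessel_gen _ 5 (fun t => @time_set_ge0 R c t c1)) => u B.
exact: time_energy_upper.
Qed.

Definition alt_vec (N : nat) i : l2 :=
  \sum_(k < N) ((-1) ^+ k)%:C%C *: basis R (val k, i).

Lemma alt_vecE N i k : alt_vec N i k = (alt R N k)%:C%C *: delta_mx 0 i.
Proof.
rewrite l2_sumE /alt; case: ltnP => [kN|Nk].
  rewrite (bigD1 (Ordinal kN))// big1 => [|j jk].
    by rewrite l2Z /basis singleE eqxx [LHS]addr0.
  rewrite l2Z /basis singleE /= ifF ?scaler0//.
  by apply/negbTE; apply: contra jk => /eqP kj; apply/eqP/val_inj.
rewrite scale0r big1// => j _; rewrite l2Z /basis singleE /= gtn_eqF ?scaler0//.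
exact: leq_trans Nk.
Qed.

Lemma not_frame_time c : 1 < c -> H_sum 16%:R c = 0 ->
  ~ frame_orbit (H := H) (time_set 16%:R c) A gen.
Proof.
move=> c1 H0 [_ [a a0 aP]]; pose i0 := Ordinal m_gt0.
(* The energy of the alternating vector stays below 116 for every N, while a lower frame bound would
   force it to be at least aN > 117. *)
pose N := Num.Def.archi_bound (117 / a).
have aN : 117 < a * N%:R.
  by rewrite -ltr_pdivrMl// mulrC; apply: archi_boundP; rewrite divr_ge0// ltW.
have := aP (alt_vec N i0);
  rewrite Re_normsq (orbit_energyE _ (fun t => @time_set_ge0 R c t c1)).
apply/negP; rewrite -ltNge; apply: (@le_lt_trans _ _ 116%:E).
  have zero (u : nat -> R) : (forall k, u k = 0) ->
      (energy (time_set 16%:R c) u <= 0)%E.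
    move=> u0; have := @time_energy_upper R c u 0 c1; rewrite mulr0; apply => n.
    by rewrite big1// => k _; rewrite u0 expr0n.
  rewrite (bigD1 i0)//=.
  have -> : reseq (alt_vec N i0) i0 = alt R N.
    by apply: funext => k; rewrite /reseq alt_vecE !mxE !eqxx mulr1.
  rewrite -[leRHS]adde0; apply: leeD; last first.
    apply: sume_le0 => i ii; rewrite -[leRHS]adde0; apply: leeD; apply: zero => k.
      by rewrite /reseq alt_vecE !mxE (negbTE ii) mulr0.
    by rewrite /imseq alt_vecE !mxE (negbTE ii) mulr0.
  rewrite -[leRHS]adde0; apply: leeD; first exact: time_energy_alternating.
  by apply: zero => k; rewrite /imseq alt_vecE !mxE !eqxx mulr1.
rewrite lte_fin; apply: (@lt_le_trans _ _ (a * N%:R)); first lra.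
rewrite ler_pM2l//; apply: le_trans (nsq_ub N (l2P _)).
rewrite -[leLHS]mulr_natr mul1r -[N in N%:R]card_ord -sumr_const.
apply: ler_sum => k _; rewrite alt_vecE rsqZ /alt ltn_ord.
rewrite /csq /= expr0n addr0 -exprM mulnC exprM sqrrN !expr1n mul1r.
apply: le_trans (csq_le_rsq _ i0); rewrite mxE !eqxx /csq /=.
by rewrite expr1n expr0n addr0.
Qed.

(** Every nonzero row k of an eigenvector forces z = [lam k]; as [lam] is injective, the eigenvector
    lives on a single row, which ranges over C^m. *)
Lemma eigenspace_opA (z : R[i]) : is_eigenvalue (H := H) A z ->
  eigenspace_dim (H := H) A z m.
Proof.
move=> [x x0 Ax].
have row_eq (y : l2) k : A y = z *: y -> y k != 0 -> z = (lam k)%:C%C.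
  move=> Ay yk; have := congr1 (fun f : l2 => f k) Ay.
  rewrite opAE l2Z => /eqP; rewrite -subr_eq0 -scalerBl scaler_eq0 (negbTE yk).
  by rewrite orbF subr_eq0 => /eqP.
have [k xk] : exists k, x k != 0.
  apply: contrapT => nx; case/eqP: x0; apply: l2_ext => k; apply/eqP.
  by apply/negPn/negP => xk; apply: nx; exists k.
have zk := row_eq _ _ Ax xk.
exists (fun i => basis R (k, i)); split.
  move=> c; rewrite single_sum => /(congr1 (fun f : l2 => f k)).
  by rewrite singleE eqxx => /rowP c0 i; have := c0 i; rewrite !mxE.
move=> y; split=> [Ay|[c ->]]; last by rewrite single_sum opA_single zk.
exists (fun i => y k 0 i); rewrite single_sum; apply: l2_ext => j.
rewrite singleE; case: eqP => [->|jk]; first by apply/rowP => i; rewrite mxE.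
apply/eqP/negPn/negP => yj; apply: jk; apply: (@lam_inj R).
by have := row_eq _ _ Ay yj; rewrite zk => -[].
Qed.

Lemma generators_ge r (G : 'I_r -> l2) :
  frame_orbit (H := H) nat_times A G -> (m <= r)%N.
Proof.
move=> [_ [a a0 aP]]; rewrite leqNgt; apply/negP => rm.
(* Column j is the conjugate of row 0 of [G j]. If r < m there is a nonzero v with vM = 0; placed in
   row 0, on which all powers of A act as scalars, it is orthogonal to every orbit. *)
pose M : 'M[R[i]]_(m, r) := \matrix_(i, j) Num.conj (G j 0%N 0 i).
have : kermx M != 0.
  rewrite kermx_eq0 /row_free neq_ltn; apply/orP; left.
  exact: leq_ltn_trans (rank_leq_col M) rm.
rewrite -nz_row_eq0; set v := nz_row _ => v0.
have vM : v *m M = 0 by apply/sub_kermxP; exact: nz_row_sub.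
have := aP (single 0%N v).
have -> : orbit_energy (H := H) nat_times A G (single 0%N v) = 0%E.
  apply: esum1 => t /nat_times01 t01; rewrite big1// => j _.
  have -> : inner (h := H) (single 0%N v) (op_pow (H := H) A t (G j)) = 0.
    have vG : rdot v (G j 0%N) = 0.
      rewrite (_ : rdot _ _ = (v *m M) 0 j); first by rewrite vM mxE.
      by rewrite mxE; apply: eq_bigr => i _; rewrite mxE.
    rewrite [inner _ _]l2dotC expr0 mul1r l2dot_single (op_powE m_gt0 _ _ t01).
    by rewrite rdotZl rdotC vG rmorph0 mulr0 rmorph0.
  by rewrite normr0 expr0n.
rewrite Re_normsq lee_fin; apply/negP; rewrite -ltNge mulr_gt0//.
apply: lt_le_trans (rsq_le_nsq 0 (l2P _)).
rewrite singleE eqxx lt_def rsq_ge0 andbT.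
by apply: contra v0 => /eqP/rsq_eq0 ->.
Qed.

Lemma positive_diagonal_opA : positive_diagonal (H := H) A.
Proof.
split; first exact: opA_continuous.
exists (nat * 'I_m)%type, (@basis R m), (fun p => lam p.1); split.
- split; first exact: basis_orthonormal.
  exact: (@lin_span_dense _ _ _ (@basis R m) id).
- by move=> p; rewrite ltW// lam_gt0.
- by move=> p; exact: opA_single.
Qed.

End Orbits.

(** * The singly generated case and the final assembly *)

Lemma carleson_frame_gen (R : realType) (i : 'I_1) :
  carleson_frame (H := l2H R 1) (@opA R 1) (gen R i).
Proof.
split; first exact: opA_continuous.
- exists (fun k => basis R (k, i)), (@lam R); split.
  + split=> [j k|].
      by rewrite [LHS](basis_orthonormal R (j, i) (k, i)) xpair_eqE eqxx andbT.
    apply: (@lin_span_dense _ _ _ _ fst); first by move=> [j a] [k b] /= ->;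
      rewrite (ord1 a) (ord1 b).
    by move=> [k a]; rewrite (ord1 a) (ord1 i).
  + by move=> k; exact: opA_single.
  + by move=> k; rewrite lam_gt0 lam_lt1.
  + exact: carleson_inf_gt0.
- have -> : (fun _ : 'I_1 => gen R i) = @gen R 1.
    by apply: funext => j; rewrite (ord1 i) (ord1 j).
  exact: frame_nat.
Qed.

Local Open Scope complex_scope.

Theorem theorem6p2 (R : realType) (c0 : R)
    (hc0 : 1 < c0 < 16%:R) (hH : H_sum 16%:R c0 = 0) (m : nat) (hm : (0 < m)%N) :
  exists (H : hilbertSpace R) (A : {linear H -> H}) (F : 'I_m -> H),
    (separable H /\ positive_diagonal A /\ contractive A) /\
    frame_orbit nat_times A F /\
    (bessel_orbit (time_set 16%:R c0) A F /\
     ~ frame_orbit (time_set 16%:R c0) A F) /\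
    (forall z : R[i], is_eigenvalue A z -> eigenspace_dim A z m) /\
    min_orbit_generators A m /\
    (m = 1%N -> forall i : 'I_m,
       carleson_frame A (F i) /\
       bessel_orbit (time_set 16%:R c0) A (fun _ : 'I_1 => F i) /\
       ~ frame_orbit (time_set 16%:R c0) A (fun _ : 'I_1 => F i)).
Proof.
have /andP[c1 _] := hc0.
exists (l2H R m), (@opA R m), (@gen R m); split.
  split; first exact: l2_separable.
  split; [exact: positive_diagonal_opA|exact: opA_contractive].
split; first exact: frame_nat.
split; first by split; [exact: bessel_time|exact: not_frame_time].
split; first exact: eigenspace_opA.
split.
  split; first by exists (@gen R m); exact: frame_nat.
  by move=> r G; exact: generators_ge.
move=> m1; subst m => i; split; first exact: carleson_frame_gen.
have -> : (fun _ : 'I_1 => gen R i) = @gen R 1.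
  by apply: funext => j; rewrite (ord1 i) (ord1 j).
by split; [exact: bessel_time|exact: not_frame_time].
Qed.
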